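(* Suppose the half spaces $H_1^+,\dots,H_m^+\subset\mathbb{R}^n$ satisfy the good clipping conditions: (A) for every $I\subset[m-1]$, $F^{|I|-1}\cap H_I=\varnothing$; (B) for every $I\subset[m-1]$ and every $\mathbf{v}\in F^{|I|}\cap H_I$, $\ \prod_{t\in I}A_{*_{\mathbf{v}}}^{(I\setminus t)\cup m}\ \prod_{t\in\bullet_{\mathbf{v}}}A_{*_{\mathbf{v}}\cup t}^{I\cup m}\ne 0$. Then $$\operatorname{vol}([0,1]^n\cap H^+)=\sum_{I\subset[m-1]}\;\sum_{\mathbf{v}\in F^{|I|}\cap H_I}\frac{(-1)^{|0_{\mathbf{v}}|+\frac{|I|(|I|+1)}{2}}\,\bigl(g_m(\mathbf{v})\,A_{*_{\mathbf{v}}}^{I}\bigr)^n}{n!\,\bigl|A_{*_{\mathbf{v}}}^{I}\bigr|\,\prod_{t\in I}A_{*_{\mathbf{v}}}^{(I\setminus t)\vee m}\,\prod_{t\in\bullet_{\mathbf{v}}}A_{*_{\mathbf{v}}\vee t}^{I\vee m}} .$$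
   Context: $n,m\ge 1$, $[k]=\{1,\dots,k\}$ (with $[0]=\varnothing$). For $i\in[m]$, $g_i(\mathbf{x})=a_{1,i}x_1+\cdots+a_{n,i}x_n+r_i$ is a non-constant real affine function on $\mathbb{R}^n$, $H_i=\{g_i=0\}$, $H_i^+=\{g_i\ge 0\}$, $H^+=\bigcap_{i\in[m]}H_i^+$, and $A=(a_{j,i})$ is the $n\times m$ coefficient matrix (the $i$-th column is the coefficient vector of $g_i$). For $I\subset[m-1]$, $H_I=\bigl(\bigcap_{i\in I}H_i\bigr)\cap H^+\setminus H_m$. $F^d$ is the set of points of $[0,1]^n$ having exactly $d$ coordinates different from $0$ and $1$ (and $F^{-1}=\varnothing$). For $\mathbf{v}\in\mathbb{R}^n$: $0_{\mathbf{v}}=\{i: v_i=0\}$, $1_{\mathbf{v}}=\{i: v_i=1\}$, $*_{\mathbf{v}}=\{i: v_i\ne 0,1\}$, $\bullet_{\mathbf{v}}=0_{\mathbf{v}}\cup 1_{\mathbf{v}}$, all regarded as lists in increasing order. For ordered lists $J$ of row indices and $K$ of column indices of equal length, $A_J^K$ is the determinant of the matrix whose $(p,q)$ entry is the entry of $A$ in row $J_p$ and column $K_q$ (the order of $J,K$ matters); $A_\varnothing^\varnothing=1$. Sets of indices are listed in increasing order; $\cup$ is union listed in increasing order, while $J\vee K$ is the concatenation of the list $J$ followed by the list $K$; a single index stands for a one-element list. $|S|$ is cardinality. $\operatorname{vol}$ is Lebesgue measure. *)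

(* Defs.v *)
From HB Require Import structures.
From mathcomp Require Import all_boot all_order all_algebra.
From mathcomp Require Import all_classical all_reals all_analysis.

Set Implicit Arguments.
Unset Strict Implicit.
Unset Printing Implicit Defensive.

Import Order.TTheory GRing.Theory Num.Theory.
Import numFieldNormedType.Exports.

Local Open Scope classical_set_scope.
Local Open Scope ring_scope.

Section lebesgue_cons.
Context (R : realType) (n : nat).
Local Open Scope ereal_scope.

Definition cons_pair (p : measurableTypeR R * n.-tuple R) : n.+1.-tuple R :=
  [tuple of p.1 :: p.2].

Lemma measurable_cons_pair : measurable_fun setT cons_pair.
Proof.
exact: (@measurable_cons _ _ (measurableTypeR R * n.-tuple R)%type R fst n snd
  measurable_fst measurable_snd).
Qed.

Variable mu : {sigma_finite_measure set (n.-tuple R) -> \bar R}.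

Definition lebesgue_cons : set (n.+1.-tuple R) -> \bar R :=
  pushforward (lebesgue_measure \x mu) cons_pair.

HB.instance Definition _ := Measure.copy lebesgue_cons
  (measure_function_pushforward__canonical__measure_function_Measure
    (lebesgue_measure \x mu) measurable_cons_pair).

Lemma lebesgue_consE (A : set R) (B : set (n.-tuple R)) :
  measurable A -> measurable B ->
  lebesgue_cons [set x | A (thead x) /\ B [tuple of behead x]] =
  lebesgue_measure A * mu B.
Proof.
move=> mA mB; rewrite -(product_measure1E lebesgue_measure mu mA mB).
rewrite /lebesgue_cons /pushforward; congr (_ _).
apply/seteqP; split=> -[a t] /=; rewrite /cons_pair theadE => -[Aa Bt];
  split=> //; move: Bt; congr B; exact: val_inj.
Qed.

Lemma measurable_cons_set (A : set R) (B : set (n.-tuple R)) :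
  measurable A -> measurable B ->
  measurable [set x : n.+1.-tuple R | A (thead x) /\ B [tuple of behead x]].
Proof.
move=> mA mB; apply: measurableI.
- rewrite -[X in measurable X]setTI.
  exact: (@measurable_tnth _ R n.+1 ord0 measurableT A mA).
- rewrite -[X in measurable X]setTI.
  exact: (@measurable_behead _ R n measurableT B mB).
Qed.

Let sigma_finite_lebesgue_cons : sigma_finite setT lebesgue_cons.
Proof.
have /sigma_finiteP[F [TF ndF Foo]] := sigma_finiteT (@lebesgue_measure R).
have /sigma_finiteP[G [TG ndG Goo]] := sigma_finiteT mu.
exists (fun k => [set x | F k (thead x) /\ G k [tuple of behead x]]).
  apply/esym/seteqP; split=> // x _.
  have [i _ Fi] : (\bigcup_i F i) (thead x) by rewrite -TF.
  have [j _ Gj] : (\bigcup_i G i) [tuple of behead x] by rewrite -TG.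
  exists (maxn i j) => //; split.
  - by move: (thead x) Fi; exact/subsetPset/ndF/leq_maxl.
  - by move: [tuple of behead x] Gj; exact/subsetPset/ndG/leq_maxr.
move=> k; have [mF Fk] := Foo k; have [mG Gk] := Goo k.
split; first exact: measurable_cons_set.
by rewrite lebesgue_consE// lte_mul_pinfty// ge0_fin_numE.
Qed.

HB.instance Definition _ := Measure_isSigmaFinite.Build _ _ _ lebesgue_cons
  sigma_finite_lebesgue_cons.

End lebesgue_cons.

(* Lebesgue measure on R^n: the n-fold product of the Lebesgue measure on R,
   characterised by lebesgueN_box. *)
Fixpoint lebesgueN (R : realType) (n : nat) :
    {sigma_finite_measure set (n.-tuple R) -> \bar R} :=
  if n is n'.+1 then lebesgue_cons (lebesgueN R n')
  else \d_([tuple] : 0.-tuple R).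

Lemma lebesgueN_box (R : realType) (n : nat) (B : 'I_n -> set R) :
  (forall j, measurable (B j)) ->
  measurable [set x : n.-tuple R | forall j, B j (tnth x j)] /\
  lebesgueN R n [set x | forall j, B j (tnth x j)] =
  (\prod_(j < n) lebesgue_measure (B j))%E.
Proof.
elim: n B => [|n IHn] B mB.
  have -> : [set x : 0.-tuple R | forall j, B j (tnth x j)] = setT.
    by apply/seteqP; split=> // x _ [].
  by split; [exact: measurableT|rewrite big_ord0 /= diracT].
have [mB' vB'] := IHn (fun j => B (lift ord0 j)) (fun j => mB _).
have tE (x : n.+1.-tuple R) j :
    tnth [tuple of behead x] j = tnth x (lift ord0 j).
  by rewrite [in RHS](tuple_eta x) tnthS.
have -> : [set x : n.+1.-tuple R | forall j, B j (tnth x j)] =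
    [set x | B ord0 (thead x) /\ [set y : n.-tuple R |
      forall j, B (lift ord0 j) (tnth y j)] [tuple of behead x]].
  apply/seteqP; split=> x /=.
    by move=> Bx; split=> [|j]; [exact: Bx|rewrite tE; exact: Bx].
  move=> [B0 B1] j; case: (unliftP ord0 j) => [j'|] ->; last exact: B0.
  by rewrite -tE; exact: B1.
split; first exact: measurable_cons_set.
by rewrite big_ord_recl -vB'; exact: lebesgue_consE.
Qed.

Section coordinates.
Context (R : realType) (n : nat).
Implicit Type v : n.-tuple R.

Definition zeros v : {set 'I_n} := [set j | tnth v j == 0]%SET.
Definition ones v : {set 'I_n} := [set j | tnth v j == 1]%SET.
Definition stars v : {set 'I_n} :=
  [set j | (tnth v j != 0) && (tnth v j != 1)]%SET.
Definition bullets v : {set 'I_n} := (zeros v :|: ones v)%SET.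

Definition cube : set (n.-tuple R) :=
  [set v | forall j, 0 <= tnth v j <= 1].

(* The dimension d is an integer so that F^{-1} makes sense (and is empty). *)
Definition cube_face (d : int) : set (n.-tuple R) :=
  cube `&` [set v | #|stars v|%:Z = d].

End coordinates.

Arguments cube {R n}.
Arguments cube_face {R n} d.

(* The half-spaces are indexed by 'I_m.+1, so there is at least one of them, and
   the distinguished last one is ord_max. *)
Section clipping.
Context (R : realType) (n m : nat).
Variables (A : 'M[R]_(n, m.+1)) (r : 'I_m.+1 -> R).
Implicit Types (i : 'I_m.+1) (I : {set 'I_m.+1}) (x v : n.-tuple R).

Definition affine i x : R := \sum_(j < n) A j i * tnth x j + r i.

Definition hyperplane i : set (n.-tuple R) := [set x | affine i x = 0].
Definition halfspace i : set (n.-tuple R) := [set x | 0 <= affine i x].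
Definition halfspaces : set (n.-tuple R) := \bigcap_i halfspace i.

Definition clip I : set (n.-tuple R) :=
  (\bigcap_(i in [set` I]) hyperplane i) `&` halfspaces `\` hyperplane ord_max.

(* A_J^K: rows of A listed by J, columns listed by K, in these orders. It is
   only meaningful for size J = size K. *)
Definition minor (J : seq 'I_n) (K : seq 'I_m.+1) : R :=
  \det (\matrix_(p < size J, q < size J)
          A (tnth (in_tuple J) p) (nth ord_max K q)).

(* enum lists a set of ordinals in increasing order. *)
Definition good_clipping : Prop :=
  (forall I, ord_max \notin I ->
     cube_face (#|I|%:Z - 1) `&` clip I = set0) /\
  (forall I, ord_max \notin I ->
     forall v, (cube_face #|I|%:Z `&` clip I) v ->
     (\prod_(t in I)
        minor (enum (stars v)) (enum (ord_max |: (I :\ t))%SET)) *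
     (\prod_(t in bullets v)
        minor (enum (t |: stars v)%SET) (enum (ord_max |: I)%SET)) != 0).

Definition clip_term I v : R :=
  (-1) ^+ (#|zeros v| + (#|I| * #|I|.+1) %/ 2)%N *
  (affine ord_max v * minor (enum (stars v)) (enum I)) ^+ n /
  (n`!%:R * `|minor (enum (stars v)) (enum I)| *
   (\prod_(t in I)
      minor (enum (stars v)) (rcons (enum (I :\ t)%SET) ord_max)) *
   (\prod_(t in bullets v)
      minor (rcons (enum (stars v)) t) (rcons (enum I) ord_max))).

End clipping.

(* Main.v *)
Require Import Defs.
From mathcomp Require Import all_boot all_order all_algebra all_fingroup.
From mathcomp Require Import all_classical all_reals all_analysis.
From mathcomp Require Import measurable_realfun ring lra.

(** Let P be the clipped cube, f = g_m, and let l_i run through all the affine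
    functions that cut P out: the g_i and the walls x_j and 1 - x_j.  The
    identity is Lawrence's formula for the volume of P, with f as the
    functional that sweeps P.

    Simplicity.  From any point of P where f > 0 one reaches a vertex without
    losing a tight constraint and without decreasing f, by moving inside the
    kernel of the tight gradients (exists_vertex_above).  At such a vertex v
    the tight gradients span, so at least as many g_i vanish as there are
    coordinates of v different from 0 and 1; the first clipping condition
    forbids more.  Hence exactly n constraints are tight at v, their gradients
    form a basis, and the minor of A on the rows of the free coordinates and
    the columns of the tight g_i is nonzero (vertex_minor).  The pairs (I, v)
    of the right-hand side are exactly these vertices (clip_vertex,
    vertex_clip).  In the expansion f = f(v) + sum lam_i l_i over the tight
    constraints, the second clipping condition says that no lam_i is zero
    (coord_neq0): f is strictly monotone along each edge at v.

    Decomposition.  Turn around the edges at v along which f increases.  The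
    resulting cone, cut at f > 0, is a simplex with apex v.  For x off the
    hyperplanes l_i = 0 with f(x) > 0, the indicator of P at x is the sum of
    the indicators of these cones, each with the sign given by the parity of
    the number of edges turned around (flipped_cones_decomposition).  This is proved for all faces of P at once,
    by induction on the dimension: x moves inside the face in a generic
    direction along which f grows.  Both sides change only when x crosses a
    facet, and then the two jumps are the two sides of the identity for that
    facet; once f(x) exceeds f at every vertex both sides vanish.

    Integration.  Integrating over f > 0 gives
    vol P = sum over v of f(v)^n / (n! |det| prod (- lam_i)), the determinant
    being that of the tight gradients (lawrence_formula).  This uses the affine
    change of variables for the product measure (lebesgueN_affine), the volume
    of the standard simplex (lebesgueN_simplex) and the fact that hyperplanes
    are null (lebesgueN_hyperplane).

    Minors.  Cramer-like identities (det_principal, minor_replace,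
    minor_border) turn |det| and the lam_i into the minors of A in the
    statement, and vertex_weight collects the signs. *)

Import Order.TTheory GRing.Theory Num.Theory.
Import numFieldNormedType.Exports.

Set Implicit Arguments.
Unset Strict Implicit.
Unset Printing Implicit Defensive.

Local Open Scope ring_scope.

(** * Signed cone decomposition of a simple polyhedron *)

(** The step by which a point may leave one hyperplane without crossing any
    other one. *)
Lemma small_scale (R : realFieldType) (I : eqType) (s : seq I) (a b : I -> R) :
  (forall i, i \in s -> 0 < a i) ->
  exists2 e, 0 < e & forall i, i \in s -> 0 < a i + e * b i.
Proof.
elim: s => [|i s IHs] a0; first by exists 1.
have [j js|e e0 He] := IHs; first by apply: a0; rewrite inE js orbT.
have ai0 : 0 < a i by apply: a0; rewrite inE eqxx.
have b1 : 0 < `|b i| + 1 by rewrite ltr_wpDl.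
pose d := a i / (`|b i| + 1).
have d0 : 0 < d by rewrite divr_gt0.
exists (Num.min e d); first by rewrite lt_min e0.
move=> j; rewrite inE => /predU1P[->|js].
  have : Num.min e d * `|b i| < a i.
    have : Num.min e d * `|b i| <= d * `|b i| by rewrite ler_wpM2r// ge_min lexx orbT.
    move=> /le_lt_trans; apply.
    by rewrite /d mulrAC ltr_pdivrMr// ltr_pM2l// ltrDl.
  have : - (Num.min e d * b i) <= Num.min e d * `|b i|.
    by rewrite -mulrN ler_wpM2l// ?le_min ?(ltW e0) ?(ltW d0)// -normrN ler_norm.
  by lra.
have := He j js; have aj0 : 0 < a j by apply: a0; rewrite inE js orbT.
have : Num.min e d <= e by rewrite ge_min lexx.
have : 0 < Num.min e d by rewrite lt_min e0.
move: (Num.min e d) => c c0 ce H.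
have [bj|bj] := lerP 0 (b j); first by rewrite ltr_wpDr// mulr_ge0// ltW.
by apply: lt_le_trans H _; rewrite lerD2l ler_wnM2r// ltW.
Qed.

(** A vector space over an infinite field is not a finite union of proper
    subspaces: the witnesses are added up one by one, each with a coefficient
    too small to spoil the functionals already dealt with. *)
Lemma generic_vector (R : realFieldType) (V : lmodType R) (S : V -> Prop)
    (K : eqType) (s : seq K) (phi : K -> V -> R) :
  S 0 -> (forall t u v, S u -> S v -> S (u + t *: v)) ->
  (forall k t u v, phi k (u + t *: v) = phi k u + t * phi k v) ->
  (forall k, k \in s -> exists2 w, S w & phi k w != 0) ->
  exists2 w, S w & forall k, k \in s -> phi k w != 0.
Proof.
move=> S0 Slin philin; elim: s => [|k s IHs] wit; first by exists 0.
have [j js|u Su us] := IHs; first by apply: wit; rewrite inE js orbT.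
have [w Sw kw] := wit k (mem_head _ _).
have [k0|k0] := eqVneq (phi k u) 0; last first.
  by exists u => // j; rewrite inE => /predU1P[->|/us].
have [|e e0 He] := @small_scale R K s (fun j => `|phi j u|) (fun j => - `|phi j w|).
  by move=> j /us; rewrite normr_gt0.
exists (u + e *: w); first exact: Slin.
move=> j; rewrite inE philin => /predU1P[->|js].
  by rewrite k0 add0r mulf_neq0// gt_eqF.
apply: contraTneq (He j js) => /eqP; rewrite addr_eq0 => /eqP ->.
by rewrite normrN normrM gtr0_norm// mulrN subrr ltxx.
Qed.

Section Decomposition.
Variables (R : realFieldType) (V : lmodType R) (J : finType).
Variables (D ell : J -> V -> R) (Df f : V -> R).
Variables (vs : seq V) (lam : V -> J -> R).

Definition active (x : V) : {set J} := [set i | ell i x == 0].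

Definition feasible (x : V) := [forall i, 0 <= ell i x].

(** The polyhedron is simple at its vertices with f > 0, which are listed by
    vs: the tight gradients there are a basis (vertices_edge gives the dual
    basis, vertices_span says that they span), and f is strictly monotone along
    each edge, lam v i being the slope along the edge that leaves the
    hyperplane i.  Here D i and Df are the linear parts of ell i and f.  The
    field vertices_exist says that each face that meets f > 0 has a vertex
    there, and that f is bounded on the polyhedron by its values at the
    vertices. *)
Record simple_above : Prop := SimpleAbove {
  ell_line : forall i x t w, ell i (x + t *: w) = ell i x + t * D i w;
  dir_line : forall i x t w, D i (x + t *: w) = D i x + t * D i w;
  f_line : forall x t w, f (x + t *: w) = f x + t * Df w;
  df_line : forall x t w, Df (x + t *: w) = Df x + t * Df w;
  vertices_uniq : uniq vs;
  vertices_feasible : forall v, v \in vs -> feasible v && (0 < f v);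
  vertices_expansion : forall v x, v \in vs ->
    f x = f v + \sum_(i in active v) lam v i * ell i x;
  vertices_lam : forall v i, v \in vs -> i \in active v -> lam v i != 0;
  vertices_edge : forall v i, v \in vs -> i \in active v ->
    exists2 u, D i u = 1 & forall j, j \in active v -> j != i -> D j u = 0;
  vertices_span : forall v w, v \in vs ->
    (forall i, i \in active v -> D i w = 0) -> w = 0;
  vertices_exist : forall y, feasible y -> 0 < f y ->
    exists2 v, v \in vs & (active y \subset active v) && (f y <= f v) }.

(** The factor of i is the indicator of l_i >= 0 if f decreases along the edge
    i at v, and minus the indicator of l_i < 0 if f increases along it.  So for
    T empty the summand of v is, up to sign, the indicator of the cone at v
    whose edges are all turned towards decreasing f; a general T gives the same
    sum inside the face on which the l_i with i in T vanish. *)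
Definition flipped_cones (T : {set J}) (x : V) : R :=
  \sum_(v <- vs | T \subset active v)
    \prod_(i in active v :\: T) ((0 <= ell i x)%R%:R - (0 < lam v i)%R%:R).

Definition facets (T : {set J}) : {set J} :=
  [set i | (i \notin T) && has (fun v => i |: T \subset active v) vs].

Hypothesis H : simple_above.

Let on_face (T : {set J}) x := forall i, i \in T -> ell i x = 0.

Lemma facetsP (T : {set J}) i : reflect (i \notin T /\ exists2 v, v \in vs &
   T \subset active v /\ ell i v = 0) (i \in facets T).
Proof.
rewrite inE; apply: (iffP andP) => -[iT].
  case/hasP => v vvs; rewrite finset.subUset finset.sub1set inE => /andP[/eqP iv Tv].
  by split => //; exists v.
move=> [v vvs [Tv iv]]; split => //; apply/hasP; exists v => //.
by rewrite finset.subUset finset.sub1set inE iv eqxx.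
Qed.

(** On the segment from the vertex v to x the function f stays positive.  The
    point where the segment leaves the polyhedron thus lies on a face that has
    a vertex with f > 0, so the constraint violated beyond that point is a
    facet. *)
Lemma feasible_by_facets (T : {set J}) v x : v \in vs -> T \subset active v ->
  on_face T x -> 0 < f x -> (forall i, i \in facets T -> 0 <= ell i x) ->
  feasible x.
Proof.
move=> vvs Tv Tx fx facx.
have /andP[Pv fv] := vertices_feasible H vvs.
apply: contraT => /forallPn[i0]; rewrite -ltNge => i0x.
(* along [v, x], the exit time from the half-space i *)
pose tau i := ell i v / (ell i v - ell i x).
pose k := [arg min_(i < i0 | ell i x < 0) tau i]%O.
have [k0 kmin] : ell k x < 0 /\ forall i, ell i x < 0 -> tau k <= tau i.
  by rewrite /k; case: arg_minP.
have vge i : 0 <= ell i v by exact: (forallP Pv).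
pose t := tau k.
have dk : 0 < ell k v - ell k x by rewrite subr_gt0; apply: lt_le_trans (vge k).
have t0 : 0 <= t by rewrite divr_ge0 ?vge// ltW.
have t1 : t < 1 by rewrite ltr_pdivrMr// mul1r ltrDl oppr_gt0.
pose y := v + t *: (x - v).
have Ey i : ell i y = (1 - t) * ell i v + t * ell i x.
  have -> : ell i x = ell i v + D i (x - v).
    by rewrite -[D _ _]mul1r -(ell_line H) scale1r addrC subrK.
  by rewrite (ell_line H); ring.
have fy : 0 < f y.
  have : f y = (1 - t) * f v + t * f x.
    have -> : f x = f v + Df (x - v).
      by rewrite -[Df _]mul1r -(f_line H) scale1r addrC subrK.
    by rewrite (f_line H); ring.
  move=> ->; apply: ltr_pwDl; first by rewrite mulr_gt0// subr_gt0.
  by rewrite mulr_ge0// ltW.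
have Py : feasible y.
  apply/forallP => i; rewrite Ey; have [ix|ix] := lerP 0 (ell i x).
    by rewrite addr_ge0// mulr_ge0// subr_ge0 ltW.
  have di : 0 < ell i v - ell i x by rewrite subr_gt0; apply: lt_le_trans (vge i).
  have := kmin i ix; rewrite -/t /tau ler_pdivlMr//; lra.
have ky : ell k y = 0 by rewrite Ey /t /tau; field; rewrite gt_eqF.
have [v' v'vs /andP[yv' _]] := vertices_exist H Py fy.
suff /facx : k \in facets T by rewrite leNgt k0.
apply/facetsP; split; first by apply/negP => /Tx kx; rewrite kx ltxx in k0.
exists v' => //; split.
  apply/fintype.subsetP => i iT; apply: (fintype.subsetP yv'); rewrite inE Ey Tx//.
  by move/fintype.subsetP: Tv => /(_ i iT); rewrite inE => /eqP ->; rewrite !mulr0 addr0.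
by have : k \in active v'; [apply: (fintype.subsetP yv'); rewrite inE ky|rewrite inE => /eqP].
Qed.

Lemma feasibleE (T : {set J}) v x : v \in vs -> T \subset active v ->
  on_face T x -> 0 < f x ->
  feasible x = [forall i in facets T, 0 <= ell i x].
Proof.
move=> vvs Tv Tx fx; apply/idP/forall_inP => [/forallP Px i _|]; first exact: Px.
exact: feasible_by_facets vvs Tv Tx fx.
Qed.

Lemma facetsU (T : {set J}) k i : k \in facets T ->
  i \in facets (k |: T) -> i \in facets T.
Proof.
move=> kT /facetsP[]; rewrite finset.in_setU1 negb_or => /andP[_ iT] [v vvs [Tv iv]].
apply/facetsP; split => //; exists v => //; split => //.
by apply: fintype.subset_trans Tv; rewrite finset.subsetU1.
Qed.

(** A direction inside the face along which f grows and which, starting at x,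
    meets the hyperplanes of the facets one at a time.  That the facets i and j
    are met simultaneously is a linear equation in w.  It does not hold
    identically: in the notation of the proof, the edge of j violates it at a
    vertex v of the facet i where l_j vanishes, and the direction from x to v
    violates it when l_j does not vanish at v. *)
Lemma generic_direction (T : {set J}) x : on_face T x -> facets T != finset.set0 ->
  (forall i, i \in facets T -> ell i x != 0) ->
  exists w, [/\ forall i, i \in T -> D i w = 0, 0 < Df w &
    forall i j, i \in facets T -> j \in facets T -> i != j ->
      ell i x * D j w - ell j x * D i w != 0].
Proof.
move=> Tx /finset.set0Pn[k kT] xT.
pose S w := forall i, i \in T -> D i w = 0.
pose phi (p : option (J * J)) w :=
  if p is Some (i, j) then ell i x * D j w - ell j x * D i w else Df w.
have D0 i : D i 0 = 0.
  by have := dir_line H i 0 1 0; rewrite scaler0 addr0 mul1r; lra.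
have Slin t u v : S u -> S v -> S (u + t *: v).
  by move=> Su Sv i iT; rewrite (dir_line H) Su// Sv// mulr0 addr0.
have philin p t u v : phi p (u + t *: v) = phi p u + t * phi p v.
  case: p => [[i j]|] /=; last exact: (df_line H).
  by rewrite !(dir_line H); ring.
pose s := None :: [seq Some p | p <- enum [pred p : J * J |
  [&& p.1 \in facets T, p.2 \in facets T & p.1 != p.2]]].
have [||w Sw ws] := @generic_vector R V S _ s phi _ Slin philin.
- by move=> i _; exact: D0.
- move=> p; rewrite inE => /predU1P[->|/mapP[[i j]]].
    case/facetsP: kT => kT [v vvs [Tv kv]].
    have kav : k \in active v by rewrite inE kv.
    have [u ku uk] := vertices_edge H vvs kav.
    exists u => [i iT|].
      rewrite uk ?(fintype.subsetP Tv)//.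
      by apply: contraNneq kT => <-.
    suff -> : phi None u = lam v k by exact: (vertices_lam H).
    have := vertices_expansion H (v + 1 *: u) vvs.
    rewrite (f_line H) mul1r => /addrI /= ->.
    rewrite (bigD1 k)//= big1 => [|i /andP[iv ik]]; rewrite (ell_line H).
      by rewrite kv ku; ring.
    by rewrite uk//; move: iv; rewrite inE => /eqP ->; ring.
  rewrite mem_enum => /and3P[/= iT jT ij] -> /=.
  case/facetsP: (iT) => iT' [v vvs [Tv iv]].
  have [jv|jv] := eqVneq (ell j v) 0.
    have jav : j \in active v by rewrite inE jv.
    have [u ju uj] := vertices_edge H vvs jav.
    exists u => [l lT|].
      rewrite uj ?(fintype.subsetP Tv)//.
      by apply: contraTneq lT => ->; case/facetsP: jT.
    by rewrite ju uj ?inE ?iv// mulr1 mulr0 subr0 xT.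
  have Dvx l : D l (v - x) = ell l v - ell l x.
    apply: (addrI (ell l x)); rewrite -[D _ _]mul1r -(ell_line H) scale1r.
    by rewrite [in LHS]addrC subrK; ring.
  exists (v - x) => [l lT|].
    rewrite Dvx Tx//; move/fintype.subsetP: Tv => /(_ l lT).
    by rewrite inE => /eqP ->; rewrite subrr.
  rewrite !Dvx iv.
  have -> : ell i x * (ell j v - ell j x) - ell j x * (0 - ell i x) = ell i x * ell j v by ring.
  by rewrite mulf_neq0// xT.
have fw : Df w != 0 by exact: (ws None (mem_head _ _)).
have ijw i j : i \in facets T -> j \in facets T -> i != j ->
      ell i x * D j w - ell j x * D i w != 0.
  move=> iT jT ij; apply: (ws (Some (i, j))); rewrite inE /=.
  by apply: map_f; rewrite mem_enum inE /= iT jT.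
have [fw0|fw0] := ltP 0 (Df w); first by exists w.
have Dw i : D i (- w) = - D i w.
  by rewrite -[- w]add0r -scaleN1r (dir_line H) D0 add0r mulN1r.
exists (- w); split => [i iT||i j iT jT ij]; first by rewrite Dw Sw// oppr0.
  have -> : Df (- w) = - Df w.
    have Df0 : Df 0 = 0.
      by have := df_line H 0 1 0; rewrite scaler0 addr0 mul1r; lra.
    by rewrite -[- w]add0r -scaleN1r (df_line H) Df0 add0r mulN1r.
  by rewrite oppr_gt0 lt_neqAle fw.
rewrite !Dw !mulrN opprK addrC -oppr_eq0 opprD opprK addrC.
by have := ijw _ _ iT jT ij; congr (_ != 0); ring.
Qed.

(** Since f(x) > f(v), some term lam_i l_i(x) of the expansion of f at v is
    positive, and this makes the factor of i vanish. *)
Lemma flipped_cones_far (T : {set J}) x : on_face T x ->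
  (forall i, i \in facets T -> ell i x != 0) ->
  (forall v, v \in vs -> f v < f x) -> flipped_cones T x = 0.
Proof.
move=> Tx xT far; rewrite /flipped_cones big_seq_cond big1// => v /andP[vvs Tv].
have : 0 < \sum_(i in active v :\: T) lam v i * ell i x.
  have := vertices_expansion H x vvs; rewrite (finset.big_setID T) /= (finset.setIidPr Tv).
  rewrite big1 ?add0r => [E|i /Tx ->]; last by rewrite mulr0.
  by have := far v vvs; rewrite E ltrDl.
move=> pos; have [i] : exists2 i, i \in active v :\: T & 0 < lam v i * ell i x.
  apply/exists_inP; apply: contraTT pos => /exists_inPn h.
  by rewrite -leNgt sumr_le0// => i /h; rewrite -leNgt.
move=> ivT li; rewrite (bigD1 i)//=; have /finset.setDP[iv _] := ivT.
have [l0|l0] := ltP 0 (lam v i).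
  by move: li; rewrite pmulr_rgt0// => /ltW ->; rewrite subrr mul0r.
have {}l0 : lam v i < 0 by rewrite lt_neqAle l0 andbT (vertices_lam H).
by move: li; rewrite nmulr_rgt0// leNgt => ->; rewrite subrr mul0r.
Qed.

(** Only the vertices on the facet k see the crossing, and only through their
    factor of k; what remains is the product that belongs to the same vertex
    inside the facet. *)
Lemma flipped_cones_jump (T : {set J}) k x y z : k \in facets T ->
  (forall i, i \in facets T -> i != k -> (0 <= ell i x) = (0 <= ell i z)) ->
  (forall i, i \in facets T -> i != k -> (0 <= ell i y) = (0 <= ell i z)) ->
  flipped_cones T x - flipped_cones T y =
  ((0 <= ell k x)%R%:R - (0 <= ell k y)%R%:R) * flipped_cones (k |: T) z.
Proof.
move=> kT xz yz; have [kT' _] := facetsP T k kT.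
have same v : v \in vs -> T \subset active v -> forall i,
    i \in active v :\: T -> i != k ->
    ((0 <= ell i x) = (0 <= ell i z)) * ((0 <= ell i y) = (0 <= ell i z)).
  move=> vvs Tv i; rewrite !inE => /andP[iT /eqP iv] ik.
  by split; [apply: xz|apply: yz] => //; apply/facetsP; split => //; exists v.
rewrite /flipped_cones -sumrB big_distrr /= (bigID (fun v => k \in active v)) /=.
rewrite addrC big_seq_cond big1 ?add0r; last first.
  move=> v /and3P[vvs Tv kv]; apply/eqP; rewrite subr_eq0; apply/eqP.
  apply: eq_bigr => i iv; have ik : i != k.
    by apply: contraNneq kv => <-; move: iv; rewrite inE => /andP[].
  by rewrite !(same v vvs Tv i iv ik).
rewrite [RHS](eq_bigl (fun v => (T \subset active v) && (k \in active v))); last first.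
  by move=> v; rewrite finset.subUset finset.sub1set andbC.
rewrite big_seq_cond [RHS]big_seq_cond.
apply: eq_bigr => v /and3P[vvs Tv kv].
have kvT : k \in active v :\: T by rewrite inE kT'.
rewrite (bigD1 k)//= [in X in _ - X](bigD1 k)//=.
have pE (g : J -> R) : \prod_(i in active v :\: (k |: T)) g i =
    \prod_(i in active v :\: T | i != k) g i.
  by apply: eq_bigl => i; rewrite !inE negb_or -andbA andbC.
rewrite pE.
under eq_bigr => i /andP[iv ik] do rewrite (same v vvs Tv i iv ik).
under [X in _ - _ * X]eq_bigr => i /andP[iv ik] do rewrite (same v vvs Tv i iv ik).
by ring.
Qed.

Lemma feasible_jump (T : {set J}) v k x z : v \in vs -> T \subset active v ->
  k \in facets T -> on_face T x -> on_face T z -> 0 < f x -> 0 < f z ->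
  ell k z = 0 ->
  (forall i, i \in facets T -> i != k -> (0 <= ell i x) = (0 <= ell i z)) ->
  feasible x = (0 <= ell k x) && feasible z.
Proof.
move=> vvs Tv kT Tx Tz fx fz kz xz; rewrite !(@feasibleE T v)//.
apply/forall_inP/andP => [h|[kx /forall_inP h] i iT].
  split; first exact: h.
  apply/forall_inP => i iT; have [->|ik] := eqVneq i k; first by rewrite kz.
  by rewrite -xz// h.
by have [->//|ik] := eqVneq i k; rewrite xz// h.
Qed.

Let claim T x := on_face T x -> 0 < f x ->
  (forall i, i \in facets T -> ell i x != 0) ->
  flipped_cones T x = (feasible x)%:R.

(** Induction on the number of facets that the ray from y in the direction w
    still has to cross.  If k is the first of them, it is crossed at z, and y'
    is a point just beyond z. *)
Lemma flipped_cones_line (T : {set J}) w v y : v \in vs -> T \subset active v ->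
  (forall k x, k \in facets T -> claim (k |: T) x) ->
  (forall i, i \in T -> D i w = 0) -> 0 < Df w ->
  (forall i j, i \in facets T -> j \in facets T -> i != j ->
    ell i y * D j w - ell j y * D i w != 0) ->
  claim T y.
Proof.
move=> vvs Tv IHT Tw fw.
pose C y := [set i in facets T | ell i y * D i w < 0].
have [N] := ubnP #|C y|; elim: N y => // N IHN y CN tie Ty fy yT.
have Tline t : on_face T (y + t *: w).
  by move=> i iT; rewrite (ell_line H) Ty// Tw// mulr0 addr0.
have fline t : 0 <= t -> 0 < f (y + t *: w).
  by move=> t0; rewrite (f_line H) ltr_wpDr// mulr_ge0// ltW.
have [C0|/finset.set0Pn[k0 k0C]] := eqVneq (C y) finset.set0.
  have up i : i \in facets T -> 0 <= ell i y * D i w.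
    move=> iT; rewrite leNgt; apply/negP => iw.
    by have : i \in C y; [rewrite inE iT|rewrite C0 inE].
  (* no facet is crossed any more, so that f can be made arbitrarily large *)
  pose t := (\sum_(v <- vs) f v) / Df w.
  have sum_ge v' : v' \in vs -> f v' <= \sum_(v <- vs) f v.
    move=> v's; rewrite (big_rem v')//= lerDl big_seq sumr_ge0// => u us.
    by have /andP[_ /ltW] := vertices_feasible H (mem_rem us).
  have t0 : 0 <= t.
    rewrite divr_ge0// ?(ltW fw)// big_seq sumr_ge0// => u us.
    by have /andP[_ /ltW] := vertices_feasible H us.
  have far v' : v' \in vs -> f v' < f (y + t *: w).
    move=> v's; rewrite (f_line H) divfK ?gt_eqF// addrC.
    by rewrite ltr_pwDr// sum_ge.
  have sgn i : i \in facets T ->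
      ((0 <= ell i (y + t *: w)) = (0 <= ell i y)) * (ell i (y + t *: w) != 0).
    move=> iT; have := up i iT; have := yT i iT; rewrite (ell_line H).
    case: (ltgtP (ell i y) 0) => // iy _.
      rewrite nmulr_rge0// => iw; have : t * D i w <= 0 by rewrite mulr_ge0_le0.
      by move=> h; have : ell i y + t * D i w < 0 by [lra]; move=> h'; rewrite leNgt h' lt_eqF.
    rewrite pmulr_rge0// => iw; have : 0 <= t * D i w by rewrite mulr_ge0.
    by move=> h; have : 0 < ell i y + t * D i w by [lra]; move=> h'; rewrite ltW// gt_eqF.
  have -> : flipped_cones T y = flipped_cones T (y + t *: w).
    rewrite /flipped_cones big_seq_cond [RHS]big_seq_cond.
    apply: eq_bigr => v' /andP[v's Tv']; apply: eq_bigr => i.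
    rewrite !inE => /andP[iT /eqP iv]; rewrite sgn//.
    by apply/facetsP; split => //; exists v'.
  rewrite flipped_cones_far// => [|i /sgn[]//].
  suff -> : feasible y = feasible (y + t *: w).
    suff /negbTE -> : ~~ feasible (y + t *: w) by [].
    apply/negP => Pt; have [v' v's /andP[_]] := vertices_exist H Pt (fline _ t0).
    by rewrite leNgt far.
  rewrite !(@feasibleE T v)//; last exact: fline.
  by apply: eq_forallb_in => i iT; rewrite sgn.
pose tau i := - ell i y / D i w.
(* tau i is the time at which the ray crosses the hyperplane of i *)
pose k := [arg min_(i < k0 | i \in C y) tau i]%O.
have [kC kmin] : k \in C y /\ forall i, i \in C y -> tau k <= tau i.
  by rewrite /k; case: arg_minP.
have /andP[kT kw] : (k \in facets T) && (ell k y * D k w < 0) by move: kC; rewrite inE.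
have w0 i : i \in C y -> D i w != 0.
  by rewrite finset.in_set => /andP[_]; apply: contraTneq => ->; rewrite mulr0 ltxx.
have tau_gt0 i : i \in C y -> 0 < tau i.
  move=> iC; have := w0 i iC; move: iC; rewrite inE => /andP[_ iw] i0.
  have -> : tau i = - (ell i y * D i w) / D i w ^+ 2 by rewrite /tau; field.
  by rewrite divr_gt0 ?oppr_gt0// exprn_even_gt0.
pose t := tau k; have t0 : 0 < t by exact: tau_gt0.
pose z := y + t *: w.
have kz : ell k z = 0 by rewrite (ell_line H) /t /tau; field; exact: w0.
have zT i : i \in facets T -> i != k -> 0 < ell i y * ell i z.
  move=> iT ik; have := tie i k iT kT ik; have iy := yT i iT.
  have -> : ell i y * D k w - ell k y * D i w = ell i z * D k w.
    by rewrite (ell_line H) /t /tau; field; exact: w0.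
  rewrite mulf_eq0 negb_or => /andP[iz _].
  rewrite lt_neqAle eq_sym mulf_neq0//= (ell_line H) mulrDr mulrCA.
  have [iC|iC] := boolP (i \in C y); last first.
    apply: addr_ge0; first by rewrite -expr2 sqr_ge0.
    apply: mulr_ge0; first exact: ltW.
    by move: iC; rewrite inE iT /= -leNgt.
  have le_t : t <= tau i by exact: kmin.
  have iw : ell i y * D i w < 0 by move: iC; rewrite inE => /andP[].
  have : tau i * (ell i y * D i w) <= t * (ell i y * D i w) by rewrite ler_nM2r.
  have -> : tau i * (ell i y * D i w) = - (ell i y * ell i y).
    by rewrite /tau; field; exact: w0.
  by lra.
have [i|e e0 He] := @small_scale R J (enum (facets T :\ k))
  (fun i => ell i z * ell i z) (fun i => ell i z * D i w).
  rewrite mem_enum => /finset.setD1P[ik iT]; rewrite -expr2 exprn_even_gt0//=.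
  by have := zT i iT ik; apply: contraTneq => ->; rewrite mulr0 ltxx.
pose y' := z + e *: w.
have y'T i : i \in facets T -> i != k -> 0 < ell i z * ell i y'.
  move=> iT ik; rewrite /y' (ell_line H i z) mulrDr mulrCA.
  by apply: He; rewrite mem_enum; apply/finset.setD1P.
have y'E : y' = y + (t + e) *: w by rewrite /y' /z scalerDl addrA.
have signs a b c : 0 < a * b :> R -> (0 <= a) = (0 <= b) /\ (a * c < 0) = (b * c < 0).
  by move=> ab; have [a0|a0|a0] := ltgtP a 0; have [b0|b0|b0] := ltgtP b 0 => //;
    try nra; rewrite ?nmulr_rlt0 ?pmulr_rlt0//.
have yz i : i \in facets T -> i != k -> (0 <= ell i y) = (0 <= ell i z).
  by move=> iT ik; have [] := signs _ _ 0 (zT i iT ik).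
have y'z i : i \in facets T -> i != k -> (0 <= ell i y') = (0 <= ell i z).
  by move=> iT ik; have [] := signs _ _ 0 (y'T i iT ik).
have Tz : on_face T z by exact: Tline.
have Ty' : on_face T y' by rewrite y'E; exact: Tline.
have fz : 0 < f z by apply: fline; exact: ltW.
have fy' : 0 < f y' by rewrite y'E; apply: fline; rewrite addr_ge0 ?ltW.
have ky' : 0 < ell k y' * D k w.
  by rewrite /y' (ell_line H k z) kz add0r -mulrA pmulr_rgt0// -expr2 exprn_even_gt0//= w0.
have Phiz : flipped_cones (k |: T) z = (feasible z)%:R.
  apply: IHT => // [i|i].
    by rewrite finset.in_setU1 => /predU1P[->//|]; exact: Tz.
  move=> ikT; have iT := facetsU kT ikT.
  have ik : i != k by move: ikT; rewrite inE finset.in_setU1 negb_or -andbA => /andP[].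
  by have := zT i iT ik; apply: contraTneq => ->; rewrite mulr0 ltxx.
have Phiy' : flipped_cones T y' = (feasible y')%:R.
  apply: IHN => //.
  - apply: leq_trans (_ : #|C y| <= N)%N; last by [].
    apply: proper_card; apply/properP; split; last first.
      by exists k => //; rewrite finset.in_set kT /= -leNgt ltW.
    apply/fintype.subsetP => i; rewrite finset.in_set => /andP[iT iy'].
    rewrite finset.in_set iT /=.
    have ik : i != k by apply: contraTneq iy' => ->; rewrite -leNgt ltW.
    have [_ ->] := signs _ _ (D i w) (zT i iT ik).
    by have [_ ->] := signs _ _ (D i w) (y'T i iT ik).
  - move=> i j iT jT ij; rewrite y'E !(ell_line H).
    have -> : (ell i y + (t + e) * D i w) * D j w - (ell j y + (t + e) * D j w) * D i w
      = ell i y * D j w - ell j y * D i w by ring.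
    exact: tie.
  - move=> i iT; have [->|ik] := eqVneq i k.
      by apply: contraTneq ky' => ->; rewrite mul0r ltxx.
    by have := y'T i iT ik; apply: contraTneq => ->; rewrite mulr0 ltxx.
apply/eqP; rewrite -(subrK (flipped_cones T y') (flipped_cones T y)).
rewrite (flipped_cones_jump kT yz y'z) Phiz Phiy'.
rewrite (feasible_jump vvs Tv kT Ty Tz fy fz kz yz).
rewrite (feasible_jump vvs Tv kT Ty' Tz fy' fz kz y'z).
by case: (feasible z); case: (0 <= ell k y); case: (0 <= ell k y');
  rewrite /=; apply/eqP; ring.
Qed.

(** The claim is proved for every face T, by induction on its dimension,
    measured by the number of constraints outside T.  A face that has a vertex
    but no facet is that vertex. *)
Theorem flipped_cones_decomposition x : 0 < f x -> (forall i, ell i x != 0) ->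
  flipped_cones finset.set0 x = (feasible x)%:R.
Proof.
move=> fx xi; suff : forall T y, claim T y by apply => // i; rewrite inE.
move=> T; have [N] := ubnP #|~: T|; elim: N T => // N IHN T TN y Ty fy yT.
have [/hasP[v vvs Tv]|/hasPn noV] := boolP (has (fun v => T \subset active v) vs); last first.
  rewrite /flipped_cones big_seq_cond big1 => [|v /andP[/noV/negbTE ->]//].
  apply/esym/eqP; rewrite pnatr_eq0 eqb0; apply/negP => Py.
  have [v vvs /andP[yv _]] := vertices_exist H Py fy.
  have /negP := noV v vvs; apply; apply: fintype.subset_trans yv.
  by apply/fintype.subsetP => i iT; rewrite inE Ty.
have [F0|F0] := eqVneq (facets T) finset.set0.
  have actE u : u \in vs -> T \subset active u -> active u = T.
    move=> uvs Tu; apply/eqP; rewrite finset.eqEsubset Tu andbT.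
    apply/fintype.subsetP => i iu; apply: contraT => iT.
    suff : i \in facets T by rewrite F0 inE.
    by apply/facetsP; split => //; exists u => //; split=> //; move: iu; rewrite inE => /eqP.
  have -> : feasible y by rewrite (feasibleE vvs Tv Ty fy); apply/forall_inP => i; rewrite F0 inE.
  rewrite /flipped_cones big_mkcond (bigD1_seq v)//=; last exact: vertices_uniq H.
  rewrite Tv (actE v)// finset.setDv finset.big_set0 big_seq_cond big1 ?addr0// => u /andP[uvs].
  case: ifP => // Tu /eqP[]; apply/subr0_eq.
  apply: (vertices_span H vvs) => i iv.
  have ell_eq0 v' : v' \in vs -> T \subset active v' -> ell i v' = 0.
    move=> v's Tv'; have : i \in active v' by rewrite actE// -(actE v).
    by rewrite inE => /eqP.
  apply: (addrI (ell i v)); rewrite -[D _ _]mul1r -(ell_line H) scale1r addrC subrK.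
  by rewrite !ell_eq0// addr0.
have [w [Tw fw tie]] := generic_direction Ty F0 yT.
apply: (flipped_cones_line vvs Tv _ Tw fw tie) => // k x' kT.
apply: IHN; apply: leq_trans (_ : #|~: T| <= N)%N => //.
have [kT' _] := facetsP T k kT.
apply: proper_card; apply/properP; split; first by rewrite finset.setCS finset.subsetU1.
by exists k; rewrite !inE ?kT'// eqxx.
Qed.

End Decomposition.

Local Open Scope classical_set_scope.
Local Open Scope ring_scope.

(** * Affine changes of variables *)

Lemma lebesgue_measure_affine (R : realType) (s k : R) (Y : set R) :
  s != 0 -> measurable Y ->
  lebesgue_measure [set x : R | Y (s * x + k)] =
  ((`|s|^-1)%:E * lebesgue_measure Y)%E.
Proof.
move=> s0 mY; pose phi (x : R) : measurableTypeR R := s * x + k.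
have mphi : measurable_fun setT phi.
  by apply: measurable_funD => //; exact: measurable_funM.
pose s' : {nonneg R} := NngNum (normr_ge0 s).
pose mu := mscale s' (pushforward (@lebesgue_measure R) phi).
suff -> : lebesgue_measure Y = mscale s' (measure_function_pushforward__canonical__measure_function_Measure lebesgue_measure mphi) Y.
  rewrite /mscale /= muleA -EFinM mulVf ?normr_eq0// mul1e; congr (_ _).
apply: lebesgue_measure_unique => // _ [[a b]] /= _ <-.
rewrite /mscale /= /pushforward lebesgue_measure_itv /= lte_fin.
have [s_gt0|s_lt0|] := ltgtP s 0; last by move=> /eqP; rewrite (negbTE s0).
- have -> : phi @^-1` `]a, b]%classic = `[(b - k) / s, (a - k) / s[%classic.
    apply/seteqP; split => x /=; rewrite !in_itv /= /phi => /andP[h1 h2]; apply/andP.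
      by rewrite ler_ndivrMr// ltr_ndivlMr// !(mulrC x); split; lra.
    by move: h1 h2; rewrite ler_ndivrMr// ltr_ndivlMr// !(mulrC x) => *; split; lra.
  rewrite lebesgue_measure_itv /= lte_fin ltr_ndivrMr// divfK// ltrD2r.
  case: ifP => // _; last by rewrite mule0.
  by rewrite ltr0_norm// -EFinB -EFinB -EFinM; congr (_%:E); field.
- have -> : phi @^-1` `]a, b]%classic = `](a - k) / s, (b - k) / s]%classic.
    apply/seteqP; split => x /=; rewrite !in_itv /= /phi => /andP[h1 h2]; apply/andP.
      by rewrite ler_pdivlMr// ltr_pdivrMr// !(mulrC x); split; lra.
    by move: h1 h2; rewrite ler_pdivlMr// ltr_pdivrMr// !(mulrC x) => *; split; lra.
  rewrite lebesgue_measure_itv /= lte_fin ltr_pdivrMr// divfK// ltrD2r.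
  case: ifP => // _; last by rewrite mule0.
  by rewrite gtr0_norm// -EFinB -EFinB -EFinM; congr (_%:E); field.
Qed.

Section BoxUniqueness.
Variables (R : realType) (n : nat).

Definition box (B : 'I_n -> set R) : set (n.-tuple R) :=
  [set x | forall j, B j (tnth x j)].

Lemma measurable_boxE (Y : set (n.-tuple R)) : measurable Y ->
  <<s [set X | exists2 B, (forall j, measurable (B j)) & X = box B] >> Y.
Proof.
apply: smallest_sub; first exact: smallest_sigma_algebra.
rewrite -bigcup_seq => X [i _] [A mA <-]; apply: sub_sigma_algebra.
exists (fun j => if j == i then A else setT).
  by move=> j; case: ifP.
apply/seteqP; split => x /=.
  by move=> [_ Ax] j; case: eqP => [->|].
by move=> /(_ i); rewrite eqxx => Ax; split.
Qed.

(** Boxes are stable under intersection and generate the product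
    sigma-algebra. *)
Lemma lebesgueN_unique (m : {measure set (n.-tuple R) -> \bar R}) :
  (forall B, (forall j, measurable (B j)) ->
    m (box B) = (\prod_(j < n) lebesgue_measure (B j))%E) ->
  forall Y, measurable Y -> lebesgueN R n Y = m Y.
Proof.
move=> mE Y /measurable_boxE; move: Y.
pose g (k : nat) := box (fun=> `[- k%:R, k%:R]%classic).
apply: (@g_sigma_algebra_measure_unique _ _ _ _ _ g).
- by move=> _ [B mB ->]; exact: (lebesgueN_box mB).1.
- by move=> k; exists (fun=> `[- k%:R, k%:R]%classic).
- apply/seteqP; split => // x _.
  have [k xk] : exists k : nat, forall j, `|tnth x j| <= k%:R.
    exists (\max_j (Num.truncn `|tnth x j|).+1)%N => j.
    apply: (@le_trans _ _ (Num.truncn `|tnth x j|).+1%:R).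
      exact/ltW/truncnS_gt.
    by rewrite ler_nat (leq_bigmax j).
  by exists k => // j /=; rewrite in_itv /= -ler_norml.
- move=> _ _ [B1 mB1 ->] [B2 mB2 ->].
  exists (fun j => B1 j `&` B2 j); first by move=> j; exact: measurableI.
  by apply/seteqP; split => x /= => [[h1 h2] j|h]; split => // j; have [] := h j.
- by move=> _ [B mB ->]; rewrite mE//; exact: (lebesgueN_box mB).2.
- move=> k; have mk (j : 'I_n) : measurable (`[- k%:R, k%:R]%classic : set R) by [].
  suff : (lebesgueN R n (g k) < +oo)%E by [].
  have E := (lebesgueN_box mk).2; rewrite -/(g k) in E; rewrite {}E.
  set p := (X in (X < _)%E); suff [] : (p < +oo /\ 0 <= p)%E by [].
  apply: (big_ind (fun e : \bar R => e < +oo /\ 0 <= e)%E) => [|x y [x1 x0] [y1 y0]|j _].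
  + by rewrite ltry.
  + by rewrite mule_ge0// lte_mul_pinfty// ge0_fin_numE.
  + by rewrite lebesgue_measure_itv /= lte_fin; case: ifP; rewrite -?EFinB ltry.
Qed.

End BoxUniqueness.

Section Sections.
Variables (R : realType) (n : nat).
Implicit Types (Y : set (n.+1.-tuple R)) (x : R) (t : n.-tuple R).

Let xsectionE Y x : xsection (@cons_pair R n @^-1` Y) x =
  [set t : n.-tuple R | Y [tuple of x :: t]].
Proof. by apply/seteqP; split => t /=; rewrite /xsection /= inE. Qed.

Let ysectionE Y t : ysection (@cons_pair R n @^-1` Y) t =
  [set x : R | Y [tuple of x :: t]].
Proof. by apply/seteqP; split => x /=; rewrite /ysection /= inE. Qed.

Let measurable_pair Y : measurable Y -> measurable (@cons_pair R n @^-1` Y).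
Proof.
by move=> mY; rewrite -[X in measurable X]setTI; exact: measurable_cons_pair.
Qed.

Lemma lebesgueNS Y :
  lebesgueN R n.+1 Y =
  (\int[lebesgue_measure]_x lebesgueN R n [set t : n.-tuple R | Y [tuple of x :: t]])%E.
Proof.
by apply: eq_integral => x _ /=; congr (lebesgueN R n _); rewrite xsectionE.
Qed.

Lemma lebesgueNS_swap Y : measurable Y ->
  lebesgueN R n.+1 Y =
  (\int[lebesgueN R n]_t lebesgue_measure [set x : R | Y [tuple of x :: t]])%E.
Proof.
move=> mY; rewrite /= /lebesgue_cons /pushforward.
rewrite (@product_measure_unique _ _ _ _ R (@lebesgue_measure R) (lebesgueN R n)
  (@lebesgue_measure R \x^ lebesgueN R n)%E _ _ (measurable_pair mY)).
  by apply: eq_integral => t _ /=; congr lebesgue_measure; rewrite ysectionE.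
by move=> A B mA mB; exact: product_measure2E.
Qed.

Lemma measurable_section Y x : measurable Y ->
  measurable [set t : n.-tuple R | Y [tuple of x :: t]].
Proof.
by move=> /measurable_pair mZ; rewrite -xsectionE; exact: measurable_xsection.
Qed.

Lemma measurable_section_swap Y t : measurable Y ->
  measurable ([set x | Y [tuple of x :: t]] : set (measurableTypeR R)).
Proof.
by move=> /measurable_pair mZ; rewrite -ysectionE; exact: measurable_ysection.
Qed.

Lemma measurable_fun_section Y : measurable Y ->
  measurable_fun setT (fun x : measurableTypeR R =>
    lebesgueN R n [set t : n.-tuple R | Y [tuple of x :: t]]).
Proof.
move=> /measurable_pair mZ.
rewrite [X in measurable_fun _ X](_ : _ = lebesgueN R n \o xsection (@cons_pair R n @^-1` Y)).
  exact: measurable_fun_xsection.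
by apply/funext => x /=; rewrite xsectionE.
Qed.

Lemma measurable_fun_section_swap Y : measurable Y ->
  measurable_fun setT (fun t : n.-tuple R =>
    lebesgue_measure [set x : R | Y [tuple of x :: t]]).
Proof.
move=> /measurable_pair mZ.
rewrite [X in measurable_fun _ X](_ : _ = @lebesgue_measure R \o ysection (@cons_pair R n @^-1` Y)).
  exact: measurable_fun_ysection.
by apply/funext => t /=; rewrite ysectionE.
Qed.

End Sections.

(** The volume of a box does not depend on the order of its sides. *)
Lemma lebesgueN_perm (R : realType) (n : nat) (s : 'S_n) (Y : set (n.-tuple R)) :
  measurable Y ->
  lebesgueN R n [set x | Y [tuple tnth x (s i) | i < n]] = lebesgueN R n Y.
Proof.
move=> mY; pose phi (x : n.-tuple R) := [tuple tnth x (s i) | i < n].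
have mphi : measurable_fun setT phi.
  apply/measurable_fun_tnthP => i.
  rewrite (_ : _ \o _ = fun x => tnth x (s i)); first exact: measurable_tnth.
  by apply/funext => x /=; rewrite tnth_mktuple.
rewrite (@lebesgueN_unique R n (measure_function_pushforward__canonical__measure_function_Measure (lebesgueN R n) mphi) _ _ mY)//.
move=> B mB; rewrite /= /pushforward.
have -> : phi @^-1` box B = box (fun j => B ((s^-1)%g j)).
  apply/seteqP; split => x /= h j; have := h.
    by move=> /(_ ((s^-1)%g j)); rewrite /phi tnth_mktuple permKV.
  by move=> /(_ (s j)); rewrite permK /phi tnth_mktuple.
rewrite (lebesgueN_box (fun j => mB _)).2.
by rewrite [RHS](reindex_inj (@perm_inj _ (s^-1)%g)).
Qed.

Section AffineMap.
Variables (R : realType).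

Definition affine_map n (M : 'M[R]_n) (c : 'I_n -> R) (x : n.-tuple R) : n.-tuple R :=
  [tuple \sum_j M i j * tnth x j + c i | i < n].

Lemma measurable_affine_form n (a : 'I_n -> R) (c : R) :
  measurable_fun setT (fun x : n.-tuple R => \sum_j a j * tnth x j + c).
Proof.
apply: measurable_funD; last exact: measurable_cst.
have := @measurable_sum _ (n.-tuple R) R setT 'I_n (index_enum 'I_n)
  (fun j x => a j * tnth x j).
apply => j; apply: measurable_funM; first exact: measurable_cst.
exact: measurable_tnth.
Qed.

Lemma measurable_affine_map n (M : 'M[R]_n) c :
  measurable_fun setT (affine_map M c).
Proof.
apply/measurable_fun_tnthP => i.
rewrite (_ : _ \o _ = fun x => \sum_j M i j * tnth x j + c i).
  exact: measurable_affine_form.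
by apply/funext => x /=; rewrite tnth_mktuple.
Qed.

End AffineMap.

(** Row 0 of M is b times the other rows, plus s in column 0; s is the Schur
    complement.  Hence if y is the image of the last n coordinates, which for
    a fixed first coordinate depends on them through an invertible matrix, the
    first coordinate of the image is s x_0 plus a function of y alone. *)
Lemma schur_factor (R : fieldType) n (M : 'M[R]_n.+1) :
  row' ord0 (col' ord0 M) \in unitmx ->
  exists s (b : 'I_n -> R),
  [/\ \det M = s * \det (row' ord0 (col' ord0 M)),
      M ord0 ord0 = s + \sum_k b k * M (lift ord0 k) ord0 &
      forall j, M ord0 (lift ord0 j) = \sum_k b k * M (lift ord0 k) (lift ord0 j)].
Proof.
move=> Du; pose M1 : 'M[R]_(1 + n) := M.
pose a := ulsubmx M1; pose b := ursubmx M1; pose c := dlsubmx M1; pose D := drsubmx M1.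
have DE : row' ord0 (col' ord0 M) = D.
  apply/matrixP => i j; rewrite !mxE; congr (M _ _); apply: val_inj => //=.
have l0 : lshift n (ord0 : 'I_1) = ord0 by apply: val_inj.
have r0 (j : 'I_n) : rshift 1 j = lift ord0 j by apply: val_inj.
rewrite DE in Du *; pose beta := b *m invmx D; pose s := (a - beta *m c) ord0 ord0.
exists s, (fun k => beta ord0 k); split.
- have ME : M1 = block_mx (a - beta *m c) beta 0 1%:M *m block_mx 1%:M 0 c D.
    rewrite mulmx_block !mulmx1 !mulmx0 ?mul0mx !mul1mx !add0r subrK.
    by rewrite mulmxKV// submxK.
  rewrite (_ : \det M = \det M1)// [in LHS]ME det_mulmx (det_ublock (a - _)).
  by rewrite (det_lblock 1%:M) !det1 mulr1 mul1r det_mx11.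
- rewrite /s !mxE l0; set S1 := (X in _ - X); set S2 := (X in _ + X).
  suff -> : S1 = S2 by rewrite subrK.
  by apply: eq_bigr => k _; rewrite !mxE l0 r0.
- move=> j; have : b = beta *m D by rewrite mulmxKV.
  move=> /matrixP/(_ ord0 j); rewrite !mxE l0 r0 => ->.
  by apply: eq_bigr => k _; congr (_ * _); rewrite !mxE !r0.
Qed.

Section ChangeOfVariables.
Variables (R : realType).

Let measurable_preim n m (phi : n.-tuple R -> m.-tuple R) Y :
  measurable_fun setT phi -> measurable Y -> measurable [set x | Y (phi x)].
Proof. by move=> mphi mY; rewrite -[X in measurable X]setTI; exact: mphi. Qed.

(** Induction on the dimension.  Up to a permutation of the coordinates, the
    minor of M without row and column 0 is invertible, because some cofactor of
    row 0 is nonzero.  For a fixed first coordinate, the induction hypothesis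
    then replaces the tail of x by its image y; for fixed y, by Fubini, only an
    affine substitution of the first coordinate is left, with slope the Schur
    complement s. *)
Theorem lebesgueN_affine n (M : 'M[R]_n) (c : 'I_n -> R) (Y : set (n.-tuple R)) :
  \det M != 0 -> measurable Y ->
  lebesgueN R n [set x | Y (affine_map M c x)] =
  ((`|\det M|^-1)%:E * lebesgueN R n Y)%E.
Proof.
elim: n M c Y => [|n IHn] M c Y M0 mY.
  rewrite det_mx00 normr1 invr1 mul1e; congr (lebesgueN R 0 _).
  by apply/seteqP; split => x /=; rewrite (tuple0 x) (tuple0 (affine_map _ _ _)).
(* the permutation s below brings column j to the front and keeps the order
   of the other columns, so that the new minor is the one complementary to (0, j) *)
wlog Du : M M0 / row' ord0 (col' ord0 M) \in unitmx.
  move=> wlog_unit.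
  have [j j0] : exists j, \det (row' ord0 (col' j M)) != 0.
    apply/existsP; apply: contraNT M0 => /existsPn h.
    rewrite (expand_det_row _ ord0) big1// => j _.
    by rewrite /cofactor (eqP (negbNE (h j))) mulr0 mulr0.
  pose s := lift_perm ord0 j (1 : 'S_n)%g.
  have detE : `|\det (col_perm s M)| = `|\det M|.
    rewrite col_permE det_mulmx normrM det_perm normr_sign ?mulr1//.
  rewrite -detE -wlog_unit; first last.
  - rewrite (_ : row' _ _ = row' ord0 (col' j M)) ?unitmxE ?unitfE//.
    by apply/matrixP => k l; rewrite !mxE lift_perm_lift perm1.
  - by rewrite -normr_eq0 detE normr_eq0.
  rewrite -[RHS](lebesgueN_perm s); last first.
    exact: measurable_preim (measurable_affine_map _ _) mY.
  congr (lebesgueN R _ _); apply/seteqP; split => x /=;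
    rewrite (_ : affine_map (col_perm s M) c _ = affine_map M c x)//;
    apply: eq_from_tnth => i; rewrite !tnth_mktuple; congr (_ + _);
    rewrite [RHS](reindex_inj (@perm_inj _ s)); apply: eq_bigr => k _;
    by rewrite mxE tnth_mktuple.
have [s [b [detE M00 M0l]]] := schur_factor Du.
set D := row' ord0 (col' ord0 M) in Du detE.
have [s0 D0] : s != 0 /\ \det D != 0.
  by move: M0; rewrite detE mulf_eq0 negb_or => /andP.
pose c' k := c (lift ord0 k).
pose kap := c ord0 - \sum_k b k * c' k.
have key (x1 : R) (x : n.-tuple R) :
    affine_map M c [tuple of x1 :: x] =
    let y := affine_map D (fun k => c' k + M (lift ord0 k) ord0 * x1) x in
    [tuple of s * x1 + (\sum_k b k * tnth y k + kap) :: y].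
  apply: eq_from_tnth => i; rewrite tnth_mktuple big_ord_recl /= tnth0.
  case: (unliftP ord0 i) => [k|] ->.
    rewrite tnthS tnth_mktuple /c'.
    under eq_bigr => j _ do rewrite tnthS.
    under [X in _ = X + _]eq_bigr => j _ do rewrite !mxE.
    by ring.
  rewrite tnth0 M00 /kap.
  under eq_bigr => j _ do rewrite tnthS M0l mulr_suml.
  rewrite exchange_big /=.
  under [X in _ = _ + (X + _)]eq_bigr => k _ do rewrite tnth_mktuple mulrDr mulrDr mulr_sumr.
  rewrite 2!big_split /= mulrDl mulr_suml.
  have -> : \sum_(k < n) b k * (M (lift ord0 k) ord0 * x1) =
            \sum_(k < n) b k * M (lift ord0 k) ord0 * x1.
    by apply: eq_bigr => k _; rewrite mulrA.
  have -> : \sum_(j < n) \sum_(i0 < n) b j * (D j i0 * tnth x i0) =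
     \sum_(j < n) \sum_(i0 < n) b j * M (lift ord0 j) (lift ord0 i0) * tnth x i0.
    by apply: eq_bigr => k _; apply: eq_bigr => l _; rewrite !mxE mulrA.
  by ring.
pose psi (x : n.+1.-tuple R) : n.+1.-tuple R :=
  [tuple of s * thead x + (\sum_k b k * tnth [tuple of behead x] k + kap) :: [tuple of behead x]].
have mpsi : measurable_fun setT psi.
  have mb : measurable_fun setT (fun x : n.+1.-tuple R => [tuple of behead x]).
    exact: measurable_behead.
  apply: measurable_cons => //.
  apply: measurable_funD.
    by apply: measurable_funM; [exact: measurable_cst|exact: measurable_tnth].
  exact: (measurableT_comp (measurable_affine_form b kap) mb).
pose W := [set x | Y (psi x)].
have mW : measurable W by exact: measurable_preim.
rewrite lebesgueNS.
transitivity (\int[lebesgue_measure]_x ((`|\det D|^-1)%:E *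
    lebesgueN R n [set t : n.-tuple R | W [tuple of x :: t]]))%E.
  apply: eq_integral => x _.
  rewrite -(IHn D (fun k => c' k + M (lift ord0 k) ord0 * x)) //; last exact: measurable_section.
  congr (lebesgueN R n _); apply/seteqP; split => t /=;
  rewrite key /W /psi /= theadE; congr Y; apply: val_inj => /=; congr (_ :: _);
  congr (_ + (_ + _)); apply: eq_bigr => k _; congr (_ * tnth _ _); exact: val_inj.
rewrite ge0_integralZl_EFin ?invr_ge0//; last exact: measurable_fun_section.
rewrite -lebesgueNS lebesgueNS_swap//.
transitivity ((`|\det D|^-1)%:E * \int[lebesgueN R n]_t ((`|s|^-1)%:E *
   lebesgue_measure [set x : R | Y [tuple of x :: t]]))%E.
  congr (_ * _)%E; apply: eq_integral => t _.
  rewrite -(lebesgue_measure_affine (\sum_k b k * tnth t k + kap)) //; last exact: measurable_section_swap.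
  congr lebesgue_measure; apply/seteqP; split => x /=;
  rewrite /W /psi /= theadE; congr Y; apply: val_inj => /=; congr (_ :: _);
  congr (_ + (_ + _)); apply: eq_bigr => k _; congr (_ * tnth _ _); exact: val_inj.
rewrite ge0_integralZl_EFin ?invr_ge0//; last exact: measurable_fun_section_swap.
rewrite -lebesgueNS_swap// muleA -EFinM detE normrM invfM; congr (_%:E * _)%E.
by rewrite mulrC.
Qed.

End ChangeOfVariables.

(** * Volume of simplices *)

Section MeasurableComparison.
Context d (T : measurableType d) (R : realType).
Variables f g : T -> R.
Hypotheses (mf : measurable_fun setT f) (mg : measurable_fun setT g).

Lemma measurable_set_lt : measurable [set x | f x < g x].
Proof.
have := measurable_fun_ltr mf mg measurableT (_ : measurable [set true]).
by rewrite setTI preimage_true; exact.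
Qed.

Lemma measurable_set_le : measurable [set x | f x <= g x].
Proof.
have := measurable_fun_ler mf mg measurableT (_ : measurable [set true]).
by rewrite setTI preimage_true; exact.
Qed.

Lemma measurable_set_eq : measurable [set x | f x = g x].
Proof.
have := measurable_fun_eqr mf mg measurableT (_ : measurable [set true]).
rewrite setTI preimage_true => h.
rewrite (_ : mkset _ = [set` fun x => f x == g x]); first exact: h.
by apply/seteqP; split => x /= /eqP.
Qed.

End MeasurableComparison.

Section SimplexVolume.
Variable R : realType.

Lemma integral_deriv_poly (p : {poly R}) (a b : R) : a < b ->
  (\int[lebesgue_measure]_(x in `]a, b[) (p^`().[x])%:E = (p.[b] - p.[a])%:E)%E.
Proof.
move=> ab; have mp : measurable_fun setT (horner p^`() : R -> R).
  by apply: continuous_measurable_fun; exact: continuous_horner.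
rewrite -(@integral_itv_bndoo R a b _ true false); last first.
  by apply/measurable_EFinP; apply: measurable_funTS.
rewrite (@continuous_FTC2 R _ (horner p)) ?EFinB//.
- by apply: continuous_subspaceT => x; exact: continuous_horner.
- split; first by move=> x _; exact: derivable_horner.
  + by apply: cvg_at_right_filter; exact: continuous_horner.
  + by apply: cvg_at_left_filter; exact: continuous_horner.
- by move=> x _; rewrite derivE.
Qed.

Definition simplex n (c : 'I_n -> R) (h : R) : set (n.-tuple R) :=
  [set x | (forall i, 0 < tnth x i) /\ \sum_i c i * tnth x i < h].

Lemma measurable_simplex n (c : 'I_n -> R) h : measurable (simplex c h).
Proof.
rewrite (_ : simplex c h = \bigcap_(i in setT) [set x | 0 < tnth x i] `&`
    [set x | \sum_i c i * tnth x i + 0 < h]).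
  apply: measurableI.
    apply: fin_bigcap_measurable => // i _.
    by apply: measurable_set_lt; [exact: measurable_cst|exact: measurable_tnth].
  by apply: measurable_set_lt; [exact: measurable_affine_form|exact: measurable_cst].
apply/seteqP; split => x /= [h1]; rewrite addr0 => h2; split => // i *;
  exact: h1.
Qed.

(** The slice at first coordinate x is the simplex of height h - c_0 x, so the
    volume is the integral of a polynomial with primitive p. *)
Theorem lebesgueN_simplex n (c : 'I_n -> R) (h : R) : (forall i, 0 < c i) -> 0 < h ->
  lebesgueN R n (simplex c h) = (h ^+ n / (n`!%:R * \prod_i c i))%:E.
Proof.
elim: n c h => [|n IHn] c h c0 h0.
  rewrite (_ : simplex c h = setT).
    by rewrite /= diracT expr0 big_ord0 fact0 mulr1 divr1.
  by apply/seteqP; split => // x _; split => [[]//|]; rewrite big_ord0.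
pose c' i := c (lift ord0 i); pose C := \prod_i c' i.
have C0 : 0 < C by apply: prodr_gt0 => i _; exact: c0.
have a0 : 0 < c ord0 by exact: c0.
pose p : {poly R} := (- (c ord0 * n.+1`!%:R * C)^-1) *: (h%:P - c ord0 *: 'X) ^+ n.+1.
have pE x : p^`().[x] = (h - c ord0 * x) ^+ n / (n`!%:R * C).
  rewrite derivZ deriv_exp derivB derivC derivZ derivX sub0r.
  rewrite !(hornerE, hornerMn, horner_exp) /=.
  rewrite factS natrM -mulr_natr; field.
  by rewrite !gt_eqF// ?ltr0n// fact_gt0.
rewrite lebesgueNS.
transitivity (\int[lebesgue_measure]_(x in `]0%R, (h / c ord0)%R[) (p^`().[x])%:E)%E.
  rewrite [RHS]integral_mkcond; apply: eq_integral => x _.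
  rewrite patchE /=; case: ifPn => [|xnot].
    rewrite inE /= in_itv /= ltr_pdivlMr// mulrC => /andP[x0 xh].
    rewrite pE -IHn//; [|by move=> i; exact: c0|by rewrite subr_gt0].
    congr (lebesgueN R n _); apply/seteqP; split => t /=.
      move=> [tpos]; rewrite big_ord_recl /= tnth0.
      under eq_bigr => i _ do rewrite tnthS.
      move=> th; split; last by rewrite /c'; lra.
      by move=> i; have := tpos (lift ord0 i); rewrite tnthS.
    move=> [tpos th]; split.
      by move=> i; case: (unliftP ord0 i) => [j|] ->; rewrite ?tnthS ?tnth0.
    rewrite big_ord_recl /= tnth0.
    under eq_bigr => i _ do rewrite tnthS.
    by move: th; rewrite /c'; lra.
  suff -> : [set t : n.-tuple R | simplex c h [tuple of x :: t]] = set0 by rewrite measure0.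
  apply/seteqP; split => t //= [tpos th]; move: xnot; apply/negP; rewrite negbK.
  rewrite inE /= in_itv /=.
  have := tpos ord0; rewrite tnth0 => x0; rewrite x0 /=.
  rewrite ltr_pdivlMr// mulrC; apply: le_lt_trans th.
  rewrite big_ord_recl tnth0 lerDl sumr_ge0// => i _.
  by rewrite mulr_ge0// ltW.
rewrite integral_deriv_poly ?divr_gt0//.
have pv x : p.[x] = - (c ord0 * n.+1`!%:R * C)^-1 * (h - c ord0 * x) ^+ n.+1.
  by rewrite !(hornerE, horner_exp).
have -> : \prod_i c i = c ord0 * C by rewrite big_ord_recl.
rewrite !pv mulr0 subr0 mulrCA divff ?gt_eqF// mulr1 subrr expr0n /=.
congr (_%:E); rewrite mulr0 sub0r; field.
by rewrite !gt_eqF// ltr0n fact_gt0.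
Qed.

(** Each slice is a hyperplane of the tail, unless the equation involves the
    first coordinate only; in that case each line in its direction meets the
    hyperplane in one point. *)
Lemma lebesgueN_hyperplane n (a : 'I_n -> R) (b : R) : (exists i, a i != 0) ->
  lebesgueN R n [set x | \sum_i a i * tnth x i + b = 0] = 0%E.
Proof.
elim: n a b => [|n IHn] a b [i ai0]; first by case: i ai0.
have E x (t : n.-tuple R) : \sum_i a i * tnth [tuple of x :: t] i =
    a ord0 * x + \sum_i a (lift ord0 i) * tnth t i.
  by rewrite big_ord_recl tnth0; under eq_bigr => j _ do rewrite tnthS.
case: (pselect (exists j, a (lift ord0 j) != 0)) => [aj|noj].
  rewrite lebesgueNS integral0_eq// => x _.
  rewrite -(IHn _ (a ord0 * x + b) aj); congr (lebesgueN R n _).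
  by apply/seteqP; split => t /=; rewrite E addrA (addrC (a _ * _)).
have az j : a (lift ord0 j) = 0 by apply: contra_notP noj => /eqP aj; exists j.
have a0 : a ord0 != 0.
  by case: (unliftP ord0 i) ai0 => [j|] ->; rewrite ?az ?eqxx.
rewrite lebesgueNS_swap ?integral0_eq//; last first.
  by apply: measurable_set_eq; [exact: measurable_affine_form|exact: measurable_cst].
move=> t _; rewrite -(lebesgue_measure_set1 (- b / a ord0)); congr lebesgue_measure.
apply/seteqP; split => x /=; rewrite E big1 ?addr0 => [|j _]; rewrite ?az ?mul0r//.
  by move=> h; have -> : - b = a ord0 * x by [lra]; rewrite mulrAC divff// mul1r.
by move=> ->; field.
Qed.

End SimplexVolume.

(** * The volume of a simple polytope *)

Section LawrenceFormula.
Variables (R : realType) (n : nat) (J : finType).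

Definition linear_form (a : 'I_n -> R) (w : 'rV[R]_n) : R := \sum_j a j * w ord0 j.

Definition row_of_tuple (x : n.-tuple R) : 'rV[R]_n := \row_j tnth x j.

Variables (a : J -> 'I_n -> R) (b : J -> R) (af : 'I_n -> R) (bf : R).

Let D i := linear_form (a i).
Let ell i x := linear_form (a i) x + b i.
Let Df := linear_form af.
Let f x := linear_form af x + bf.

Variables (vs : seq 'rV[R]_n) (e : 'rV[R]_n -> 'I_n -> J).
Variable lam : 'rV[R]_n -> J -> R.

Let N v : 'M[R]_n := \matrix_(k, j) a (e v k) j.

Hypothesis vs_uniq : uniq vs.
Hypothesis vsP : forall v, v \in vs -> feasible ell v && (0 < f v).
Hypothesis e_inj : forall v, v \in vs -> injective (e v).
Hypothesis e_active : forall v, v \in vs -> active ell v = [set e v k | k in 'I_n]%SET.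
Hypothesis N_unit : forall v, v \in vs -> \det (N v) != 0.
Hypothesis af_lam : forall v j, v \in vs ->
  af j = \sum_k lam v (e v k) * a (e v k) j.
Hypothesis lam0 : forall v k, v \in vs -> lam v (e v k) != 0.
Hypothesis vs_exist : forall y, feasible ell y -> 0 < f y ->
  exists2 v, v \in vs & (active ell y \subset active ell v) && (f y <= f v).

Let linear_formD c x t w :
  linear_form c (x + t *: w) = linear_form c x + t * linear_form c w.
Proof.
rewrite /linear_form mulr_sumr -big_split; apply: eq_bigr => j _.
by rewrite !mxE /=; ring.
Qed.

Let ell_e v k : v \in vs -> ell (e v k) v = 0.
Proof.
move=> vvs; have : e v k \in active ell v by rewrite e_active// imset_f.
by rewrite inE => /eqP.
Qed.

Let sum_active v (F : J -> R) : v \in vs ->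
  \sum_(i in active ell v) F i = \sum_k F (e v k).
Proof.
by move=> vvs; rewrite e_active// big_imset//= => k l _ _; exact: e_inj.
Qed.

Let f_expansion v x : v \in vs -> f x = f v + \sum_k lam v (e v k) * ell (e v k) x.
Proof.
move=> vvs; have -> : \sum_k lam v (e v k) * ell (e v k) x =
    \sum_k lam v (e v k) * linear_form (a (e v k)) (x - v).
  apply: eq_bigr => k _; congr (_ * _).
  have := ell_e k vvs; rewrite /ell -scaleN1r linear_formD; lra.
have -> : \sum_k lam v (e v k) * linear_form (a (e v k)) (x - v) = linear_form af (x - v).
  rewrite /linear_form; under eq_bigr => k _ do rewrite mulr_sumr.
  rewrite exchange_big; apply: eq_bigr => j _ /=; rewrite (af_lam j vvs) mulr_suml.
  by apply: eq_bigr => k _; rewrite mulrA.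
by rewrite /f -[x - v]scale1r -scaleN1r scalerDr !scale1r linear_formD; ring.
Qed.

Let simple : simple_above D ell Df f vs lam.
Proof.
split => //.
- by move=> i x t w; rewrite /ell linear_formD addrAC.
- by move=> i x t w; rewrite /D linear_formD.
- by move=> x t w; rewrite /f linear_formD addrAC.
- by move=> x t w; rewrite /Df linear_formD.
- by move=> v x vvs; rewrite sum_active// -f_expansion.
- by move=> v i vvs; rewrite e_active// => /imsetP[k _ ->]; exact: lam0.
- move=> v i vvs; rewrite e_active// => /imsetP[k _ ->].
  pose u : 'rV[R]_n := (invmx (N v) *m delta_mx k ord0 : 'cV_n)^T.
  have uE l : D (e v l) u = (l == k)%:R.
    have : N v *m (invmx (N v) *m delta_mx k ord0 : 'cV_n) = delta_mx k ord0.
      by rewrite mulKVmx// unitmxE unitfE N_unit.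
    move=> /matrixP/(_ l ord0); rewrite !mxE eqxx andbT => <-.
    by apply: eq_bigr => j _; rewrite !mxE.
  exists u; first by rewrite uE eqxx.
  move=> j /imsetP[l _ ->] lk; rewrite uE.
  by have [kl|] := eqVneq l k; first by rewrite kl eqxx in lk.
- move=> v w vvs h; apply: trmx_inj; rewrite trmx0.
  have Nu : N v \in unitmx by rewrite unitmxE unitfE N_unit.
  rewrite -[w^T](mulKmx Nu).
  rewrite (_ : N v *m w^T = 0) ?mulmx0//; apply/matrixP => k l; rewrite !mxE.
  rewrite -[RHS](h (e v k)) ?e_active ?imset_f//.
  by apply: eq_bigr => j _; rewrite !mxE ord1.
Qed.

Let ellT i (x : n.-tuple R) : ell i (row_of_tuple x) = \sum_j a i j * tnth x j + b i.
Proof. by congr (_ + _); apply: eq_bigr => j _; rewrite mxE. Qed.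

Let fT (x : n.-tuple R) : f (row_of_tuple x) = \sum_j af j * tnth x j + bf.
Proof. by congr (_ + _); apply: eq_bigr => j _; rewrite mxE. Qed.

(** The flipped cone at v, cut at f > 0.  The functions - lam_i l_i are
    positive on it and sum to f(v) - f, so in these coordinates it is the
    standard simplex of height f(v). *)
Let cone v : set (n.-tuple R) :=
  [set x | (forall k, 0 < - lam v (e v k) * ell (e v k) (row_of_tuple x)) /\
           0 < f (row_of_tuple x)].

Let coneE v : v \in vs -> cone v =
  [set x | simplex (fun=> 1) (f v)
     (affine_map (\matrix_(k, j) (- lam v (e v k) * a (e v k) j))
        (fun k => - lam v (e v k) * b (e v k)) x)].
Proof.
move=> vvs; have E x k : tnth (affine_map (\matrix_(k, j) (- lam v (e v k) * a (e v k) j))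
        (fun k => - lam v (e v k) * b (e v k)) x) k = - lam v (e v k) * ell (e v k) (row_of_tuple x).
  rewrite tnth_mktuple ellT mulrDr mulr_sumr; congr (_ + _).
  by apply: eq_bigr => j _; rewrite mxE mulrA.
have F x : (0 < f (row_of_tuple x)) =
   (\sum_k 1 * (- lam v (e v k) * ell (e v k) (row_of_tuple x)) < f v).
  rewrite (f_expansion _ vvs) -[RHS]subr_gt0; congr (0 < f v + _).
  by rewrite -sumrN; apply: eq_bigr => k _; rewrite mul1r mulNr opprK.
apply/seteqP; split => x; rewrite /cone /simplex /= F.
  by move=> [h1 h2]; split => [k|]; rewrite ?E//; under eq_bigr => k _ do rewrite E.
move=> [h1]; under eq_bigr => k _ do rewrite E; move=> h2; split => // k.
by have := h1 k; rewrite E.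
Qed.

Let weight v := f v ^+ n / (n`!%:R * `|\det (N v)| * \prod_k - lam v (e v k)).

Let sgn v : R := \prod_k (-1) ^+ (0 < lam v (e v k))%R.

Let lebesgue_cone v : v \in vs ->
  measurable (cone v) /\ lebesgueN R n (cone v) = (sgn v * weight v)%:E.
Proof.
move=> vvs; have /andP[_ fv0] := vsP vvs.
have detE : \det (\matrix_(k, j) (- lam v (e v k) * a (e v k) j)) =
    (\prod_k - lam v (e v k)) * \det (N v).
  rewrite (_ : \matrix_(k, j) _ = diag_mx (\row_k - lam v (e v k)) *m N v).
    rewrite det_mulmx det_diag; congr (_ * _).
    by apply: eq_bigr => k _; rewrite mxE.
  by apply/matrixP => k j; rewrite mul_diag_mx !mxE.
have prod0 : \prod_k - lam v (e v k) != 0.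
  by apply/prodf_neq0 => k _; rewrite oppr_eq0 lam0.
rewrite coneE//; split.
  rewrite -[X in measurable X]setTI; apply: measurable_affine_map => //.
  exact: measurable_simplex.
rewrite lebesgueN_affine; [|by rewrite detE mulf_neq0 ?N_unit|exact: measurable_simplex].
rewrite lebesgueN_simplex// -EFinM; congr (_%:E).
rewrite big1 ?mulr1// detE normrM /weight.
have -> : `|\prod_k - lam v (e v k)| = sgn v * \prod_k - lam v (e v k).
  rewrite normr_prod -big_split; apply: eq_bigr => k _ /=; rewrite normrN.
  have [l0|l0] := ltP 0 (lam v (e v k)); first by rewrite gtr0_norm//= expr1 mulN1r opprK.
  by rewrite ler0_norm//= expr0 mul1r.
have s2 : sgn v * sgn v = 1.
  rewrite /sgn -big_split big1// => k _ /=.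
  by rewrite -expr2 -exprM mulnC exprM sqrrN !expr1n.
have s0 : sgn v != 0 by apply: contra_eq_neq s2 => ->; rewrite mul0r eq_sym oner_eq0.
have d0 : `|\det (N v)| != 0 by rewrite normr_eq0 N_unit.
have nf : n`!%:R != 0 :> R by rewrite pnatr_eq0 -lt0n fact_gt0.
rewrite -[LHS]mul1r -[X in X * _]s2; field.
by rewrite prod0 s0 d0 nf.
Qed.

Let indic_decomposition x : (forall i, ell i (row_of_tuple x) != 0) ->
  0 < f (row_of_tuple x) ->
  (feasible ell (row_of_tuple x))%:R =
  \sum_(v <- vs) sgn v * (\1_(cone v) x : R).
Proof.
move=> ex fx; rewrite -(flipped_cones_decomposition simple fx ex).
rewrite /flipped_cones (eq_bigl xpredT); last by move=> v; rewrite finset.sub0set.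
rewrite big_seq [RHS]big_seq; apply: eq_bigr => v vvs.
rewrite finset.setD0 e_active// big_imset/=; last by move=> k l _ _; exact: e_inj.
have factor k : (0 <= ell (e v k) (row_of_tuple x))%R%:R - (0 < lam v (e v k))%R%:R =
    (-1) ^+ (0 < lam v (e v k))%R *
    (0 < - lam v (e v k) * ell (e v k) (row_of_tuple x))%R%:R :> R.
  have := ex (e v k); have := lam0 k vvs.
  move: (lam v (e v k)) (ell _ _) => l y l0 y0.
  case: (ltgtP l 0) (l0) => // l_sg _; case: (ltgtP y 0) (y0) => // y_sg _ /=.
  - by rewrite ltNge (_ : - l * y <= 0) ?subrr ?mulr0//; nra.
  - by rewrite (_ : 0 < - l * y) ?subr0 ?mulr1//; nra.
  - by rewrite (_ : 0 < - l * y) ?sub0r ?mulr1//; nra.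
  - by rewrite ltNge (_ : - l * y <= 0) ?subrr ?mulr0//; nra.
under eq_bigr => k _ do rewrite factor.
rewrite big_split -/(sgn v) /=; congr (_ * _); rewrite indicE.
have [xv|xv] := boolP (x \in cone v).
  rewrite big1// => k _; move: xv; rewrite inE => -[h _].
  by rewrite h.
have /existsP[k kx] : [exists k, ~~ (0 < - lam v (e v k) * ell (e v k) (row_of_tuple x))].
  rewrite -negb_forall; apply: contra xv => /forallP h; rewrite inE; split => //.
by rewrite (bigD1 k)//= (negbTE kx) mul0r.
Qed.

(** Integrate the decomposition over the region f > 0 minus the hyperplanes
    l_i = 0; what is left out of the polytope is null.  For a vertex v, the
    family e v lists the constraints tight at v. *)
Theorem lawrence_formula :
  (forall i, exists j, a i j != 0) -> (exists j, af j != 0) ->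
  (forall x, feasible ell x -> 0 <= f x) ->
  lebesgueN R n [set x | feasible ell (row_of_tuple x)] = (\sum_(v <- vs) weight v)%:E.
Proof.
move=> a0 af0 Pf.
pose P := [set x | feasible ell (row_of_tuple x)].
pose Z i := [set x : n.-tuple R | \sum_j a i j * tnth x j + b i = 0].
pose Zf := [set x : n.-tuple R | \sum_j af j * tnth x j + bf = 0].
pose Z' := Zf `|` \bigcup_(i in setT) Z i.
have mZ i : measurable (Z i).
  by apply: measurable_set_eq; [exact: measurable_affine_form|exact: measurable_cst].
have mZf : measurable Zf.
  by apply: measurable_set_eq; [exact: measurable_affine_form|exact: measurable_cst].
have mU : measurable (\bigcup_(i in setT) Z i) by apply: fin_bigcup_measurable.
have mZ' : measurable Z' by exact: measurableU.
have nullZ' : lebesgueN R n Z' = 0%E.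
  have nullU A B : measurable A -> measurable B -> lebesgueN R n A = 0%E ->
      lebesgueN R n B = 0%E -> lebesgueN R n (A `|` B) = 0%E.
    move=> mA mB A0 B0; apply/eqP; rewrite eq_le measure_ge0 andbT.
    by rewrite -(adde0 0%E) -[X in (X + _)%E]A0 -[X in (_ + X)%E]B0 measureU2.
  apply: (nullU) => //; first exact: lebesgueN_hyperplane.
  rewrite (_ : \bigcup_(i in setT) Z i = \big[setU/set0]_i Z i); last first.
    by rewrite -bigcup_seq; apply: eq_bigcupl; split => i //= _; rewrite mem_index_enum.
  suff [] : measurable (\big[setU/set0]_i Z i) /\ lebesgueN R n (\big[setU/set0]_i Z i) = 0%E by [].
  apply: (big_ind (fun A => measurable A /\ lebesgueN R n A = 0%E)) => [|A B [mA A0] [mB B0]|i _].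
  - by split; [exact: measurable0|exact: measure0].
  - by split; [exact: measurableU|exact: nullU].
  - by split => //; exact: lebesgueN_hyperplane.
pose Dpos := [set x : n.-tuple R | 0 < \sum_j af j * tnth x j + bf].
have mDpos : measurable Dpos.
  by apply: measurable_set_lt; [exact: measurable_cst|exact: measurable_affine_form].
pose D0 := Dpos `\` Z'.
have mD0 : measurable D0 by exact: measurableD.
have mP : measurable P.
  rewrite (_ : P = \bigcap_(i in setT) [set x : n.-tuple R | 0 <= \sum_j a i j * tnth x j + b i]).
    apply: fin_bigcap_measurable => // i _.
    by apply: measurable_set_le; [exact: measurable_cst|exact: measurable_affine_form].
  apply/seteqP; split => x /=.
    by move=> /forallP Px i _ /=; rewrite -ellT.
  by move=> Px; apply/forallP => i; rewrite ellT; exact: Px.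
have offD0 A : measurable A -> A `<=` Dpos `|` Zf ->
    lebesgueN R n (A `&` D0) = lebesgueN R n A.
  move=> mA AD; have mAD0 : measurable (A `&` D0) by exact: measurableI.
  have mAZ : measurable (A `&` Z') by exact: measurableI.
  have AE : A = (A `&` D0) `|` (A `&` Z').
    rewrite -setIUr; apply/esym/setIidPl => x Ax.
    have [xZ|xZ] := pselect (Z' x); [by right|left; split => //].
    by case: (AD x Ax) => // xf; case: xZ; left.
  have AZ0 : lebesgueN R n (A `&` Z') = 0%E.
    apply/eqP; rewrite eq_le measure_ge0 andbT -nullZ' le_measure ?inE//.
  have dis : (A `&` D0) `&` (A `&` Z') = set0.
    by apply/seteqP; split => x // [[_ [_ nZ]] [_ /nZ]].
  have : lebesgueN R n A = (lebesgueN R n (A `&` D0) + lebesgueN R n (A `&` Z'))%E.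
    by rewrite [X in lebesgueN R n X]AE; exact: measureU.
  by rewrite AZ0 adde0.
rewrite -/P -offD0//; last first.
  move=> x Px /=; have := Pf _ Px; rewrite fT le_eqVlt => /predU1P[/esym ?|]; [by right|by left].
rewrite -integral_indic//.
(* cutting off at members of vs makes all summands integrable, as the linearity
   of the integral requires *)
pose ind v : n.-tuple R -> R := if v \in vs then \1_(cone v) else \1_set0.
have mcone v : v \in vs -> measurable (cone v) by move=> /lebesgue_cone[].
have ind_int v : (lebesgueN R n).-integrable D0 (EFin \o ind v).
  rewrite /ind; have [vvs|_] := boolP (v \in vs).
    apply: (@integrableS _ _ _ _ setT) => //; apply/integrableP; split.
      by apply/measurable_EFinP; apply: measurable_indic; exact: mcone.
    rewrite (eq_integral (fun x => (\1_(cone v) x)%:E)); last first.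
      by move=> t _; rewrite gee0_abs// lee_fin.
    rewrite integral_indic ?setIT//; last exact: mcone.
    suff : (lebesgueN R n (cone v) < +oo)%E by [].
    by have [_ ->] := lebesgue_cone vvs; rewrite ltry.
  have := @integrable0 _ _ R (lebesgueN R n) D0; apply: eq_integrable => //.
  by move=> x _; rewrite /= indicE in_set0.
transitivity (\int[lebesgueN R n]_(x in D0) (\sum_(v <- vs)
    (sgn v)%:E * (ind v x)%:E))%E.
  apply: eq_integral => x; rewrite inE => -[Dx nZ].
  rewrite big_seq (eq_bigr (fun v => (sgn v * (\1_(cone v) x))%:E)); last first.
    by move=> v vvs; rewrite /ind vvs EFinM.
  rewrite -big_seq sumEFin -indic_decomposition ?fT//.
    by rewrite indicE /P; congr ((nat_of_bool _)%:R%:E); apply/idP/idP; rewrite inE.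
  move=> i; rewrite ellT; apply/eqP => xi; apply: nZ; right; exists i => //.
rewrite integral_sum//; last by move=> v; apply: integrableZl => //; exact: ind_int.
rewrite -sumEFin big_seq [RHS]big_seq; apply: eq_bigr => v vvs.
rewrite integralZl//; last exact: ind_int.
rewrite (eq_integral (fun x => (\1_(cone v) x)%:E)); last by move=> x _; rewrite /ind vvs.
rewrite integral_indic//; last exact: mcone.
transitivity ((sgn v)%:E * lebesgueN R n (cone v `&` D0))%E; first by [].
rewrite offD0; [|exact: mcone|by move=> x [_]; rewrite fT; left].
have [_ ->] := lebesgue_cone vvs; rewrite -EFinM mulrA; congr (_%:E).
suff -> : sgn v * sgn v = 1 by rewrite mul1r.
rewrite /sgn -big_split big1// => k _ /=.
by rewrite -expr2 -exprM mulnC exprM sqrrN !expr1n.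
Qed.

End LawrenceFormula.

(** * Reaching a vertex *)

Section VertexExistence.
Variables (R : realFieldType) (V : lmodType R) (J : finType).
Variables (D ell : J -> V -> R) (Df f : V -> R).
Hypothesis ell_line : forall i x t w, ell i (x + t *: w) = ell i x + t * D i w.
Hypothesis f_line : forall x t w, f (x + t *: w) = f x + t * Df w.
Hypothesis D_opp : forall i w, D i (- w) = - D i w.
Hypothesis Df_opp : forall w, Df (- w) = - Df w.
Hypothesis bounded : forall w, w != 0 -> exists i, D i w < 0.

(** As long as the tight gradients do not span, move along a direction that
    they annihilate, oriented so that f does not decrease, until a further
    constraint becomes tight; this happens because the polyhedron is
    bounded. *)
Lemma exists_vertex_above y : feasible ell y -> exists v,
  [/\ feasible ell v, active ell y \subset active ell v, f y <= f v &
      forall w, (forall i, i \in active ell v -> D i w = 0) -> w = 0].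
Proof.
have [N] := ubnP #|~: active ell y|; elim: N y => // N IHN y yN Py.
have [spans|] := pselect (forall w, (forall i, i \in active ell y -> D i w = 0) -> w = 0).
  by exists y; split.
move=> /existsNP[w0 /not_implyP[w0y /eqP w0_neq0]].
have [w [wy w_neq0 fw]] : exists w, [/\ forall i, i \in active ell y -> D i w = 0,
    w != 0 & 0 <= Df w].
  have [fw0|fw0] := leP 0 (Df w0); first by exists w0.
  exists (- w0); split; [|by rewrite oppr_eq0|by rewrite Df_opp oppr_ge0 ltW].
  by move=> i iy; rewrite D_opp w0y// oppr0.
have [i0 i0w] := bounded w_neq0.
pose tau i := ell i y / - D i w.
pose k := [arg min_(i < i0 | D i w < 0) tau i]%O.
have [kw kmin] : D k w < 0 /\ forall i, D i w < 0 -> tau k <= tau i.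
  by rewrite /k; case: arg_minP.
have yge i : 0 <= ell i y by exact: (forallP Py).
have t0 : 0 <= tau k by rewrite divr_ge0// oppr_ge0 ltW.
pose z := y + tau k *: w.
have Pz : feasible ell z.
  apply/forallP => i; rewrite ell_line; have [iw|iw] := leP 0 (D i w).
    by rewrite addr_ge0// mulr_ge0.
  by have := kmin i iw; rewrite {2}/tau ler_pdivlMr ?oppr_gt0//; lra.
have kz : k \in active ell z.
  by rewrite inE ell_line /tau; apply/eqP; field; rewrite lt_eqF.
have yz : active ell y \subset active ell z.
  apply/fintype.subsetP => i iy; rewrite inE ell_line wy// mulr0 addr0.
  by move: iy; rewrite inE.
have [|//|v [Pv zv fv sp]] := IHN z.
  apply: leq_trans (_ : #|~: active ell y| <= N)%N => //.
  apply: proper_card; apply/properP; split; first by rewrite finset.setCS.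
  exists k; rewrite ?inE; last by move: kz; rewrite inE => ->.
  by apply: contraTN kw => /eqP ky; rewrite wy ?ltxx// inE ky.
exists v; split => //; first exact: fintype.subset_trans zv.
by apply: le_trans fv; rewrite f_line lerDl mulr_ge0.
Qed.

End VertexExistence.

(** * Determinants and minors *)

Section Determinants.
Variable R : comNzRingType.

Lemma det_reindex n1 n2 (E : n1 = n2) (g : 'I_n1 -> 'I_n2) (M : 'M[R]_n2) :
  injective g -> \det (\matrix_(i, j) M (g i) (g j)) = \det M.
Proof.
move=> g_inj; subst n2.
have -> : \matrix_(i, j) M (g i) (g j) = row_perm (perm g_inj) (col_perm (perm g_inj) M).
  by apply/matrixP => i j; rewrite !mxE !permE.
rewrite row_permE col_permE !det_mulmx !det_perm mulrCA -signr_addb.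
by rewrite odd_permV addbb mulr1.
Qed.

(** Listing the indices of S before the others makes M block triangular; the
    same reordering of rows and columns does not change the determinant. *)
Lemma det_principal n (S : {set 'I_n}) (M : 'M[R]_n) (s : 'I_n -> R) :
  (forall i j, i \notin S -> M i j = s i *+ (i == j)) ->
  \det M = \det (\matrix_(p < #|S|, q < #|S|) M (enum_val p) (enum_val q)) *
           \prod_(i in ~: S) s i.
Proof.
move=> Ms.
pose g (i : 'I_(#|S| + #|~: S|)) : 'I_n :=
  match fintype.split i with inl p => enum_val p | inr p => enum_val p end.
have gl p : g (lshift _ p) = enum_val p by rewrite /g -[lshift _ p]/(unsplit (inl p)) unsplitK.
have gr p : g (rshift _ p) = enum_val p by rewrite /g -[rshift _ p]/(unsplit (inr p)) unsplitK.
have g_inj : injective g.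
  move=> i j; rewrite -[i]splitK -[j]splitK.
  case: (fintype.split i) (fintype.split j) => p [] q /=; rewrite ?gl ?gr.
  - by move=> /enum_val_inj ->.
  - by move=> pq; have := enum_valP q; rewrite -pq inE enum_valP.
  - by move=> pq; have := enum_valP p; rewrite pq inE enum_valP.
  - by move=> /enum_val_inj ->.
rewrite -(@det_reindex _ _ _ g) ?cardsC ?card_ord//.
set B := \matrix_(p < #|S|, q < #|S|) M (enum_val p) (enum_val q).
have -> : \matrix_(i, j) M (g i) (g j) =
    block_mx B (\matrix_(p < #|S|, q < #|~: S|) M (enum_val p) (enum_val q)) 0
      (diag_mx (\row_q s (enum_val q))).
  apply/matrixP => i j; rewrite -[i]splitK -[j]splitK mxE.
  case: (fintype.split i) (fintype.split j) => p [] q /=; rewrite ?gl ?gr.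
  - by rewrite block_mxEul mxE.
  - by rewrite block_mxEur mxE.
  - rewrite block_mxEdl mxE Ms; last by have := enum_valP p; rewrite inE.
    have := enum_valP p; rewrite inE; case: eqP => // ->.
    by rewrite enum_valP.
  - rewrite block_mxEdr !mxE Ms; last by have := enum_valP p; rewrite inE.
    by rewrite (inj_eq enum_val_inj).
rewrite det_ublock det_diag; congr (_ * _).
rewrite [RHS]big_enum_val.
by apply: eq_bigr => q _; rewrite mxE.
Qed.

(** X arises from B by deleting the column q and appending the combination nu
    of the columns of B; only nu_q B_q contributes, and moving the last column
    to place q explains the sign. *)
Lemma det_replace_col k (B X : 'M[R]_k.+1) (nu : 'I_k.+1 -> R) q :
  col' ord_max X = col' q B ->
  (forall p, X p ord_max = \sum_l nu l * B p l) ->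
  \det X = (-1) ^+ (k + q) * (nu q * \det B).
Proof.
move=> XB Xmax; rewrite (expand_det_col _ ord_max).
have cofE p : cofactor X p ord_max = (-1) ^+ (k + q) * cofactor B p q.
  rewrite /cofactor XB mulrA -exprD; congr (_ * _).
  by rewrite -signr_odd -[RHS]signr_odd; congr (_ ^+ _); rewrite /= !oddD;
    case: (odd p); case: (odd k); case: (odd q).
under eq_bigr => p _ do rewrite cofE Xmax mulrCA mulr_suml.
rewrite -mulr_sumr; congr (_ * _); rewrite exchange_big /=.
have adj l : \sum_p B p l * cofactor B p q = \det B *+ (q == l).
  have := mul_adj_mx B => /matrixP/(_ q l); rewrite !mxE => <-.
  by apply: eq_bigr => p _; rewrite mxE mulrC.
under eq_bigr => l _ do under eq_bigr => p _ do rewrite -mulrA.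
under eq_bigr => l _ do rewrite -mulr_sumr adj.
by rewrite (bigD1 q)//= eqxx big1 ?addr0// => l lq; rewrite eq_sym (negbTE lq) mulr0.
Qed.

(** Subtracting from the last column the combination nu of the other ones
    leaves mu in the corner and 0 above it. *)
Lemma det_border k (B : 'M[R]_k) (X : 'M[R]_(k + 1)) (nu : 'I_k -> R) mu :
  ulsubmx X = B -> (forall i, X i (rshift k ord0) =
     \sum_l nu l * X i (lshift 1 l) + mu *+ (i == rshift k ord0)) ->
  \det X = mu * \det B.
Proof.
move=> XB Xcol.
have -> : X = block_mx B 0 (dlsubmx X) mu%:M *m block_mx 1%:M (\col_l nu l) 0 1%:M.
  rewrite mulmx_block !mulmx1 !mulmx0 ?mul0mx !addr0.
  rewrite -[LHS]submxK XB; congr block_mx; apply/matrixP => i j; rewrite !mxE (ord1 j) ?(ord1 i).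
    rewrite Xcol eq_lrshift mulr0n addr0; apply: eq_bigr => l _.
    by rewrite -XB !mxE mulrC.
  rewrite Xcol; congr (_ + _); last by rewrite (ord1 (0 : 'I_1)) eqxx.
  by apply: eq_bigr => l _; rewrite !mxE mulrC.
by rewrite det_mulmx det_lblock det_ublock !det1 !mulr1 det_mx11 mxE mulrC.
Qed.

Lemma sign_replace_col K :
  \prod_(q < K) (-1) ^+ (K.-1 + q) = (-1) ^+ (K + (K * K.+1) %/ 2) :> R.
Proof.
have powE : \prod_(q < K) (-1) ^+ (K.-1 + q) = (-1) ^+ (\sum_(q < K) (K.-1 + q))%N :> R.
  by rewrite (big_morph (fun e => (-1) ^+ e) (exprD _) (expr0 _)).
rewrite powE big_split /= sum_nat_const card_ord.
rewrite -signr_odd -[RHS]signr_odd; congr (_ ^+ _); congr nat_of_bool.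
have -> : (\sum_(q < K) q = 'C(K, 2))%N by rewrite -bin2_sum big_mkord.
have -> : ((K * K.+1) %/ 2 = 'C(K, 2) + K)%N.
  by rewrite divn2 -[X in (X * _)%N]/(K.+1.-1) mulnC -bin2 binS bin1.
rewrite !oddD oddM; case: K {powE} => //= K.
by case: (odd K); case: (odd _).
Qed.

End Determinants.

Lemma enum_setD1 (T : finType) (S : {set T}) t : enum (S :\ t)%SET = rem t (enum S).
Proof.
rewrite rem_filter ?enum_uniq// /enum_mem -filter_predI.
by apply: eq_filter => x; rewrite /= !inE.
Qed.

Lemma enum_setU1_max n (S : {set 'I_n.+1}) : ord_max \notin S ->
  enum (ord_max |: S)%SET = rcons (enum S) ord_max.
Proof.
move=> maxS; rewrite /enum_mem -enumT enum_ordSr !filter_rcons /= !inE eqxx (negbTE maxS) /=.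
congr rcons; rewrite !filter_map; congr (map _ (map _ _)); apply: eq_filter => i; rewrite /= !inE.
by rewrite -val_eqE /= ltn_eqF.
Qed.

Lemma nth_rem (T : eqType) (x0 t : T) s i :
  nth x0 (rem t s) i = nth x0 s (bump (index t s) i).
Proof.
elim: s i => [|x s IHs] i /=; first by rewrite !nth_nil.
case: eqP => _; first by [].
by case: i => [|i] //=; rewrite IHs bumpS.
Qed.

Section Minors.
Variables (R : realType) (n m : nat) (A : 'M[R]_(n, m.+1)).
Implicit Types (J : seq 'I_n) (K : seq 'I_m.+1).

Lemma minorE (j0 : 'I_n) k J K : size J = k -> minor A J K =
  \det (\matrix_(p < k, q < k) A (nth j0 J p) (nth ord_max K q)).
Proof.
move=> <-; congr (\det _); apply/matrixP => p q; rewrite !mxE.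
by rewrite (tnth_nth j0).
Qed.

Lemma norm_minor_perm J J' K : perm_eq J J' -> `|minor A J K| = `|minor A J' K|.
Proof.
case: J' => [|j0 J'] JJ'; first by rewrite (perm_nilP JJ').
have /tuple_permP[s Js] : perm_eq J (in_tuple (j0 :: J')) by [].
have sz : size J = size (j0 :: J') by exact: perm_size.
rewrite (minorE j0 _ sz) (minorE j0 (J := j0 :: J') _ erefl).
set B := (X in _ = `|\det X|).
have -> : \matrix_(p < size (j0 :: J'), q < size (j0 :: J')) A (nth j0 J p) (nth ord_max K q) = row_perm s B.
  apply/matrixP => p q; rewrite !mxE; congr (A _ _).
  by rewrite Js -tnth_nth tnth_mktuple (tnth_nth j0).
by rewrite row_permE det_mulmx det_perm normrM normr_sign mul1r.
Qed.

Lemma minor_replace J K k (nu : 'I_k -> R) (q : 'I_k) :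
  size J = k -> size K = k -> uniq K ->
  (forall j, j \in J -> A j ord_max = \sum_l nu l * A j (nth ord_max K l)) ->
  minor A J (rcons (rem (nth ord_max K q) K) ord_max) =
  (-1) ^+ (k.-1 + q) * (nu q * minor A J K).
Proof.
case: k nu q => [|k] nu q; first by case: q.
case: J => // j0 J sJ sK uK Jnu.
rewrite !(minorE j0 (k := k.+1))//; apply: det_replace_col.
  apply/matrixP => p l; rewrite !mxE; congr (A _ _).
  have lk : (l < k)%N := ltn_ord l.
  have -> : (lift ord_max l : nat) = l by rewrite /= /bump leqNgt lk.
  by rewrite nth_rcons size_rem ?mem_nth ?sK//= lk nth_rem index_uniq ?sK.
move=> p; rewrite !mxE nth_rcons size_rem ?mem_nth ?sK// ltnn eqxx.
rewrite Jnu ?mem_nth ?sJ//.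
by apply: eq_bigr => l _; rewrite mxE.
Qed.

Lemma minor_border J K k (nu : 'I_k -> R) t mu :
  size J = k -> size K = k ->
  (forall j, j \in J -> A j ord_max = \sum_l nu l * A j (nth ord_max K l)) ->
  A t ord_max = \sum_l nu l * A t (nth ord_max K l) + mu ->
  minor A (rcons J t) (rcons K ord_max) = mu * minor A J K.
Proof.
move=> sJ sK Jnu tmu.
have sJt : size (rcons J t) = (k + 1)%N by rewrite size_rcons sJ addn1.
rewrite (minorE t _ sJt) (minorE t _ sJ).
apply: (det_border (nu := nu)).
  apply/matrixP => p q; rewrite !mxE /= !nth_rcons sJ sK.
  by have := ltn_ord p; have := ltn_ord q; rewrite /= => -> ->.
move=> i; rewrite !mxE /= addn0 [nth ord_max (rcons _ _) _]nth_rcons sK ltnn eqxx.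
under eq_bigr => l _ do rewrite !mxE /= [nth ord_max (rcons _ _) _]nth_rcons sK ltn_ord.
case: (split_ordP i) => [p|p] ->; rewrite /= nth_rcons sJ.
  by rewrite ltn_ord eq_lrshift mulr0n addr0 Jnu// mem_nth// sJ.
by rewrite (ord1 p) (ord1 ord0) eqxx mulr1n /= addn0 ltnn eqxx.
Qed.

End Minors.

Lemma big_enum_nth (R : Type) (idx : R) (op : Monoid.com_law idx) (T : finType)
    (x0 : T) (S : {set T}) k (F : T -> R) : #|S| = k ->
  \big[op/idx]_(j in S) F j = \big[op/idx]_(p < k) F (nth x0 (enum S) p).
Proof. by move=> <-; rewrite -big_enum (big_nth x0) big_mkord -cardE. Qed.

(** * The vertices of the clipped cube *)

Section ClippedCube.
Variables (R : realType) (n m : nat) (A : 'M[R]_(n, m.+1)) (r : 'I_m.+1 -> R).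

(** inl i stands for g_i >= 0, inr (k, true) for x_k >= 0 and inr (k, false)
    for 1 - x_k >= 0.  The constraint of g_m is included; it is never tight
    where g_m > 0. *)
Definition facet : finType := ('I_m.+1 + 'I_n * bool)%type.

Definition facet_normal (i : facet) (j : 'I_n) : R :=
  match i with
  | inl i => A j i
  | inr (k, b) => (if b then 1 else - 1) *+ (j == k)
  end.

Definition facet_offset (i : facet) : R :=
  match i with inl i => r i | inr (_, b) => if b then 0 else 1 end.

Definition facet_form (i : facet) (x : 'rV[R]_n) : R :=
  linear_form (facet_normal i) x + facet_offset i.

Local Notation ell := facet_form.
Local Notation dir i := (linear_form (facet_normal i)).

Definition tuple_of_row (u : 'rV[R]_n) : n.-tuple R := [tuple u ord0 j | j < n].

Lemma tuple_of_rowK : cancel tuple_of_row (@row_of_tuple R n).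
Proof. by move=> u; apply/rowP => j; rewrite mxE tnth_mktuple. Qed.

Lemma row_of_tupleK : cancel (@row_of_tuple R n) tuple_of_row.
Proof. by move=> x; apply: eq_from_tnth => j; rewrite tnth_mktuple mxE. Qed.

Lemma facet_form_line i x t w : ell i (x + t *: w) = ell i x + t * dir i w.
Proof.
rewrite /facet_form addrAC; congr (_ + _); rewrite /linear_form mulr_sumr -big_split.
by apply: eq_bigr => j _; rewrite !mxE /=; ring.
Qed.

Lemma dirN i w : dir i (- w) = - dir i w.
Proof. by rewrite /linear_form -sumrN; apply: eq_bigr => j _; rewrite mxE mulrN. Qed.

Lemma dir_inr k b w : dir (inr (k, b)) w = (if b then 1 else - 1) * w ord0 k.
Proof.
rewrite /linear_form (bigD1 k)//= eqxx mulr1n big1 ?addr0// => j /negbTE jk.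
by rewrite jk mulr0n mul0r.
Qed.

Lemma facet_form_inr k b x :
  ell (inr (k, b)) (row_of_tuple x) = if b then tnth x k else 1 - tnth x k.
Proof. by rewrite /facet_form dir_inr mxE; case: b => /=; ring. Qed.

Lemma facet_form_inl i x : ell (inl i) (row_of_tuple x) = affine A r i x.
Proof. by congr (_ + _); apply: eq_bigr => j _; rewrite mxE. Qed.

Lemma feasibleP x : feasible ell (row_of_tuple x) <-> (cube `&` halfspaces A r) x.
Proof.
split=> [/forallP Px|[cx hx]].
  split=> [j|i _]; last by have := Px (inl i); rewrite facet_form_inl.
  have := Px (inr (j, true)); have := Px (inr (j, false)); rewrite !facet_form_inr.
  by rewrite subr_ge0 => -> ->.
apply/forallP => -[i|[k b]]; first by rewrite facet_form_inl; exact: hx.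
by rewrite facet_form_inr; have /andP[] := cx k; case: b => //; rewrite subr_ge0.
Qed.

Lemma facets_bounded w : w != 0 -> exists i, dir i w < 0.
Proof.
move=> w0; have [k wk] : exists k, w ord0 k != 0.
  apply/existsP; apply: contraNT w0 => /existsPn h; apply/eqP/rowP => k.
  by rewrite mxE; apply/eqP; rewrite -[_ == _]negbK h.
have [wk0|wk0] := ltP (w ord0 k) 0.
  by exists (inr (k, true)); rewrite dir_inr mul1r.
by exists (inr (k, false)); rewrite dir_inr mulN1r oppr_lt0 lt_neqAle eq_sym wk.
Qed.

Definition tight x : {set 'I_m.+1} := [set i | affine A r i x == 0]%SET.

Definition spanning x := forall w,
  (forall i, i \in active ell (row_of_tuple x) -> dir i w = 0) -> w = 0.

Definition vertex x :=
  [/\ feasible ell (row_of_tuple x), 0 < affine A r ord_max x & spanning x].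

Lemma active_inl i x : (inl i \in active ell (row_of_tuple x)) = (i \in tight x).
Proof. by rewrite !inE facet_form_inl. Qed.

Lemma active_inr k b x : (inr (k, b) \in active ell (row_of_tuple x)) =
  (if b then tnth x k == 0 else tnth x k == 1).
Proof. by rewrite !inE facet_form_inr; case: b => //; rewrite subr_eq0 eq_sym. Qed.

Lemma max_tight x : 0 < affine A r ord_max x -> ord_max \notin tight x.
Proof. by move=> x0; rewrite inE gt_eqF. Qed.

Lemma tight_clip x (I : {set 'I_m.+1}) : feasible ell (row_of_tuple x) ->
  0 < affine A r ord_max x -> I \subset tight x -> clip A r I x.
Proof.
move=> /feasibleP[_ hx] fx /fintype.subsetP Ix; split; last first.
  by rewrite /hyperplane /= => x0; rewrite x0 ltxx in fx.
by split => // i /Ix; rewrite inE => /eqP.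
Qed.

Hypothesis hn : (0 < n)%N.
Let j0 : 'I_n := Ordinal hn.

Hypothesis clipA : forall I : {set 'I_m.+1}, ord_max \notin I ->
  cube_face (#|I|%:Z - 1) `&` clip A r I = set0.

(** Dropping some of the tight constraints keeps the point in the set H_I, so
    if there were too many of them, the first clipping condition would be
    violated by a subset with one element more than there are free
    coordinates. *)
Lemma tight_le_stars x : feasible ell (row_of_tuple x) ->
  0 < affine A r ord_max x -> (#|tight x| <= #|stars x|)%N.
Proof.
move=> Px fx; rewrite leqNgt; apply/negP => lt_card.
have [I [Ix cardI]] : exists I : {set 'I_m.+1}, I \subset tight x /\ #|I| = #|stars x|.+1.
  exists [set i in take #|stars x|.+1 (enum (tight x))]%SET; split.
    by apply/fintype.subsetP => i; rewrite inE => /mem_take; rewrite mem_enum.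
  rewrite cardsE (card_uniqP _) ?take_uniq ?enum_uniq// size_takel//.
  by rewrite -cardE.
have maxI : ord_max \notin I by apply: contraNN (max_tight fx); exact: (fintype.subsetP Ix).
have [cx _] := (feasibleP x).1 Px.
suff : (cube_face (#|I|%:Z - 1) `&` clip A r I) x by rewrite clipA.
split; last exact: tight_clip.
by split => //=; rewrite cardI -addn1 PoszD addrK.
Qed.

(** A row vector in the left kernel of the block of A on the free coordinates
    and the tight g_i, extended by 0, is annihilated by all tight gradients.
    Since these span, the rows of the block are independent; the preceding
    bound then makes it square. *)
Lemma vertex_minor x : vertex x -> #|tight x| = #|stars x| /\
  minor A (enum (stars x)) (enum (tight x)) != 0.
Proof.
move=> [Px fx sp]; set S := stars x; set I := tight x.
pose B := \matrix_(p < #|S|, q < #|I|) A (nth j0 (enum S) p) (nth ord_max (enum I) q).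
have Bfree : row_free B.
  rewrite -kermx_eq0; apply/rowV0P => u /sub_kermxP uB.
  pose w : 'rV[R]_n := \row_j if (insub (index j (enum S)) : option 'I_#|S|) is Some p then u ord0 p else 0.
  have wS (p : 'I_#|S|) : w ord0 (nth j0 (enum S) p) = u ord0 p.
    rewrite mxE index_uniq ?enum_uniq -?cardE// insubT //= => pS.
    by congr (u _ _); apply: val_inj.
  have wnS j : j \notin S -> w ord0 j = 0.
    by rewrite -mem_enum => jS; rewrite mxE insubF// memNindex// -cardE ltnn.
  suff w0 : w = 0 by apply/rowP => p; rewrite -wS w0 !mxE.
  apply: sp => -[i|[k b]].
    rewrite active_inl => iI.
    have /matrixP/(_ ord0) := uB.
    have qI : (index i (enum I) < #|I|)%N by rewrite cardE index_mem mem_enum.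
    move=> /(_ (Ordinal qI)); rewrite !mxE => <-.
    rewrite /linear_form (bigID (mem S)) /= [X in _ + X]big1 ?addr0; last first.
      by move=> j /wnS ->; rewrite mulr0.
    rewrite (big_enum_nth _ j0 _ erefl); apply: eq_bigr => q _.
    by rewrite wS !mxE /= nth_index ?mem_enum// mulrC.
  rewrite active_inr dir_inr => kb; rewrite wnS ?mulr0//.
  by rewrite inE; case: b kb => /eqP ->; rewrite ?eqxx ?oner_eq0.
have cardE' : #|I| = #|S|.
  apply/eqP; rewrite eqn_leq tight_le_stars//=.
  by move: Bfree; rewrite /row_free => /eqP {1}<-; exact: rank_leq_col.
split => //; rewrite (minorE A j0 (k := #|S|)) -?cardE//.
have det_free l : l = #|S| -> row_free (\matrix_(p < #|S|, q < l)
    A (nth j0 (enum S) p) (nth ord_max (enum I) q)) ->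
    \det (\matrix_(p < #|S|, q < #|S|) A (nth j0 (enum S) p) (nth ord_max (enum I) q)) != 0.
  by move=> ->; rewrite row_free_unit unitmxE unitfE.
exact: det_free cardE' Bfree.
Qed.

Lemma vertex_above x : feasible ell (row_of_tuple x) ->
  0 < affine A r ord_max x -> exists2 y, vertex y &
  active ell (row_of_tuple x) \subset active ell (row_of_tuple y) /\
  affine A r ord_max x <= affine A r ord_max y.
Proof.
move=> Px fx.
have [v [Pv xv fxv sp]] := exists_vertex_above facet_form_line
  (facet_form_line (inl ord_max)) dirN (dirN (inl ord_max)) facets_bounded Px.
rewrite -(tuple_of_rowK v) in Pv xv fxv sp; rewrite !facet_form_inl in fxv.
exists (tuple_of_row v) => //; split => //; exact: lt_le_trans fxv.
Qed.

(** Move from x to a vertex y at which all constraints tight at x are still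
    tight.  At y there are at most as many free coordinates, at least as many
    tight g_i, and equally many of both; as the two numbers agree at x too,
    the same constraints are tight at x and y. *)
Lemma clip_vertex x (I : {set 'I_m.+1}) : ord_max \notin I ->
  (cube_face #|I|%:Z `&` clip A r I) x -> vertex x /\ tight x = I.
Proof.
move=> maxI [[cx /eqP]]; rewrite eqz_nat => /eqP cardI [[Ix hx] /eqP fx0].
have fx : 0 < affine A r ord_max x.
  by rewrite lt_neqAle eq_sym fx0; exact: hx.
have Px : feasible ell (row_of_tuple x) by apply/feasibleP.
have It : I \subset tight x by apply/fintype.subsetP => i iI; rewrite inE; apply/eqP; exact: Ix.
have tI : tight x = I.
  by apply/esym/eqP; rewrite eqEcard It -cardI tight_le_stars.
split => //; split => //.
have [y vy [xy _]] := vertex_above Px fx.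
have [cardy _] := vertex_minor vy.
have sub_tight : tight x \subset tight y.
  apply/fintype.subsetP => i; rewrite -!active_inl; exact: (fintype.subsetP xy).
have sub_stars : stars y \subset stars x.
  apply/fintype.subsetP => k; rewrite !inE -(active_inr k true) -(active_inr k false).
  rewrite -(active_inr k true x) -(active_inr k false x) => /andP[h1 h2].
  by apply/andP; split; [apply: contra h1|apply: contra h2]; exact: (fintype.subsetP xy).
have eq_tight : tight x = tight y.
  apply/eqP; rewrite eqEcard sub_tight tI -cardI cardy; exact: subset_leq_card.
have eq_stars : stars y = stars x.
  by apply/eqP; rewrite eqEcard sub_stars cardI -tI eq_tight cardy leqnn.
suff actE : active ell (row_of_tuple x) = active ell (row_of_tuple y).
  by have [_ _ sp] := vy; move=> w h; apply: sp; rewrite -actE.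
apply/eqP; rewrite finset.eqEsubset xy; apply/fintype.subsetP => -[i|[k b]].
  by rewrite !active_inl eq_tight.
have xyk c : inr (k, c) \in active ell (row_of_tuple x) ->
    inr (k, c) \in active ell (row_of_tuple y) by exact: (fintype.subsetP xy).
move: (xyk true) (xyk false); rewrite !active_inr.
have : (k \in stars x) = (k \in stars y) by rewrite eq_stars.
rewrite !inE; case: b; case: (eqVneq (tnth x k) 0) => //= _;
  case: (eqVneq (tnth x k) 1) => //= _ kst xk0 xk1 /eqP yk; move: kst xk0 xk1;
  rewrite yk ?eqxx ?oner_eq0 ?(eq_sym 0 1) ?oner_eq0 //= => _.
- by move=> _ /(_ isT).
- by move=> /(_ isT).
Qed.

Lemma vertex_active_inj x y : vertex x ->
  active ell (row_of_tuple x) = active ell (row_of_tuple y) -> x = y.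
Proof.
move=> [_ _ sp] xy; apply: (can_inj row_of_tupleK); apply/subr0_eq/sp => i ix.
have := ix; rewrite xy inE => /eqP iy; move: ix; rewrite inE => /eqP ix'.
apply: (addrI (ell i (row_of_tuple y))); rewrite -[dir i _]mul1r -facet_form_line.
by rewrite scale1r addrC subrK ix' iy addr0.
Qed.

Lemma vertices_enum : exists2 vs : seq (n.-tuple R), uniq vs &
  forall x, x \in vs <-> vertex x.
Proof.
pose vertex_of (B : {set facet}) : option (n.-tuple R) :=
  if pselect (exists x, vertex x /\ active ell (row_of_tuple x) = B) is left h
  then Some (projT1 (cid h)) else None.
exists (undup (pmap vertex_of (enum {set facet}))); first exact: undup_uniq.
move=> x; rewrite mem_undup mem_pmap; split => [/mapP[B _]|vx].
  by rewrite /vertex_of; case: pselect => // h [->]; case: cid => y [].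
apply/mapP; exists (active ell (row_of_tuple x)); first by rewrite mem_enum.
rewrite /vertex_of; case: pselect => [h|]; last by case; exists x.
by congr Some; case: cid => y [_ yx] /=; exact: vertex_active_inj.
Qed.

(** Enumerates the constraints tight at a vertex by the coordinates: the wall
    of k if x_k is 0 or 1, and otherwise the tight g_i of the same rank as k
    among the free coordinates.  With this order the rows of basis_mx that
    belong to walls are diagonal, and the principal block of the free
    coordinates is the transpose of the matrix of the minor of A. *)
Definition basis (x : n.-tuple R) (k : 'I_n) : facet :=
  if tnth x k == 0 then inr (k, true)
  else if tnth x k == 1 then inr (k, false)
  else inl (nth ord_max (enum (tight x)) (index k (enum (stars x)))).

Definition basis_mx x : 'M[R]_n := \matrix_(k, j) facet_normal (basis x k) j.

Definition wall_sign (x : n.-tuple R) (k : 'I_n) : R := if tnth x k == 0 then 1 else - 1.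

(** The coefficient lam of the constraint basis x k in the expansion of g_m at
    the vertex x. *)
Definition coord x (k : 'I_n) : R :=
  ((\row_j A j ord_max : 'rV_n) *m invmx (basis_mx x)) ord0 k.

Lemma basis_star x k : k \in stars x ->
  basis x k = inl (nth ord_max (enum (tight x)) (index k (enum (stars x)))).
Proof. by rewrite inE /basis => /andP[/negbTE -> /negbTE ->]. Qed.

Lemma basis_bullet x k : k \notin stars x -> basis x k = inr (k, tnth x k == 0).
Proof. by rewrite inE negb_and !negbK /basis; case: eqP => //= _ ->. Qed.

Lemma index_star x k : vertex x -> k \in stars x ->
  (index k (enum (stars x)) < #|tight x|)%N.
Proof. by move=> /vertex_minor[-> _] kS; rewrite cardE index_mem mem_enum. Qed.

Lemma basis_inj x : vertex x -> injective (basis x).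
Proof.
move=> vx k l; have [kS|kS] := boolP (k \in stars x);
  have [lS|lS] := boolP (l \in stars x); rewrite ?(basis_star kS) ?(basis_star lS)
    ?(basis_bullet kS) ?(basis_bullet lS) => // -[].
  move=> /eqP; rewrite nth_uniq ?enum_uniq -?cardE ?index_star// => /eqP kl.
  by rewrite -[k](nth_index j0 (s := enum (stars x))) ?mem_enum// kl nth_index ?mem_enum.
by [].
Qed.

Lemma active_basis x : vertex x ->
  active ell (row_of_tuple x) = [set basis x k | k in 'I_n]%SET.
Proof.
move=> vx; apply/setP => i; apply/idP/imsetP => [|[k _ ->]].
  case: i => [i|[k b]]; last first.
    rewrite active_inr => kb; exists k => //; rewrite basis_bullet.
      by case: b kb => /eqP ->; rewrite ?eqxx ?oner_eq0.
    by rewrite inE; case: b kb => /eqP ->; rewrite ?eqxx ?oner_eq0.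
  rewrite active_inl => it; have it' : (index i (enum (tight x)) < #|stars x|)%N.
    by rewrite -(vertex_minor vx).1 cardE index_mem mem_enum.
  exists (nth j0 (enum (stars x)) (index i (enum (tight x)))) => //.
  rewrite basis_star; last by rewrite -mem_enum mem_nth// -cardE.
  by rewrite index_uniq ?enum_uniq -?cardE// nth_index// mem_enum.
have [kS|kS] := boolP (k \in stars x); last first.
  rewrite basis_bullet// active_inr; move: kS; rewrite inE negb_and !negbK.
  by case: eqP.
by rewrite basis_star// active_inl -mem_enum mem_nth// -cardE index_star.
Qed.

Lemma basis_mx_bullet x k j : k \notin stars x ->
  basis_mx x k j = wall_sign x k *+ (k == j).
Proof. by move=> kS; rewrite mxE basis_bullet//= (eq_sym j). Qed.

Lemma basis_mx_star x p j : (p < #|stars x|)%N ->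
  basis_mx x (nth j0 (enum (stars x)) p) j = A j (nth ord_max (enum (tight x)) p).
Proof.
move=> pS; have kS : nth j0 (enum (stars x)) p \in stars x.
  by rewrite -mem_enum mem_nth// -cardE.
by rewrite mxE (basis_star kS) /= index_uniq ?enum_uniq// -cardE.
Qed.

Lemma norm_wall_sign x k : `|wall_sign x k| = 1.
Proof. by rewrite /wall_sign; case: ifP; rewrite ?normrN normr1. Qed.

Lemma norm_det_basis x : `|\det (basis_mx x)| =
  `|minor A (enum (stars x)) (enum (tight x))|.
Proof.
rewrite (det_principal (S := stars x) (s := wall_sign x)); last first.
  by move=> k j; exact: basis_mx_bullet.
rewrite normrM normr_prod big1 ?mulr1 => [|k _]; last exact: norm_wall_sign.
rewrite (minorE A j0 (k := #|stars x|)) -?cardE// -det_tr; congr `|\det _|.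
apply/matrixP => p q; rewrite [LHS]mxE [LHS]mxE !(enum_val_nth j0) basis_mx_star//.
by rewrite !mxE.
Qed.

Lemma coordE x j : vertex x -> A j ord_max = \sum_k coord x k * basis_mx x k j.
Proof.
move=> vx; have Nu : basis_mx x \in unitmx.
  by rewrite unitmxE unitfE -normr_eq0 norm_det_basis normr_eq0 (vertex_minor vx).2.
have := mulmxKV Nu (\row_j A j ord_max : 'rV_n) => /rowP/(_ j).
by rewrite mxE mxE => <-.
Qed.

Let nu x (p : 'I_#|stars x|) : R := coord x (nth j0 (enum (stars x)) p).

Lemma coord_sum x (g : 'I_n -> R) : \sum_k coord x k * g k =
  \sum_p @nu x p * g (nth j0 (enum (stars x)) p) + \sum_(k in ~: stars x) coord x k * g k.
Proof.
rewrite (bigID (mem (stars x))) /= (big_enum_nth _ j0 _ erefl); congr (_ + _).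
by apply: eq_bigl => k; rewrite finset.in_setC.
Qed.

Lemma coord_star x j : vertex x -> j \in stars x ->
  A j ord_max = \sum_p @nu x p * A j (nth ord_max (enum (tight x)) p).
Proof.
move=> vx jS; rewrite (coordE j vx) coord_sum [X in _ + X]big1 ?addr0.
  by apply: eq_bigr => p _; rewrite basis_mx_star.
move=> k; rewrite inE => kS; rewrite basis_mx_bullet//.
by case: eqP kS => [->|_]; rewrite ?jS// mulr0.
Qed.

Lemma coord_bullet x t : vertex x -> t \notin stars x ->
  A t ord_max = \sum_p @nu x p * A t (nth ord_max (enum (tight x)) p) +
    coord x t * wall_sign x t.
Proof.
move=> vx tS; rewrite (coordE t vx) coord_sum; congr (_ + _).
  by apply: eq_bigr => p _; rewrite basis_mx_star.
rewrite (bigD1 t) /=; last by rewrite finset.in_setC.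
rewrite (basis_mx_bullet t tS) eqxx big1 ?addr0// => k /andP[].
by rewrite finset.in_setC => kS kt; rewrite basis_mx_bullet// (negbTE kt) mulr0.
Qed.

Lemma minor_tight x (q : 'I_#|stars x|) : vertex x ->
  minor A (enum (stars x))
    (rcons (enum (tight x :\ nth ord_max (enum (tight x)) q)%SET) ord_max) =
  (-1) ^+ (#|stars x|.-1 + q) * (@nu x q * minor A (enum (stars x)) (enum (tight x))).
Proof.
move=> vx; rewrite enum_setD1; apply: minor_replace; rewrite -?cardE ?enum_uniq//.
  exact: (vertex_minor vx).1.
by move=> j; rewrite mem_enum; exact: coord_star.
Qed.

Lemma minor_bullet x t : vertex x -> t \notin stars x ->
  minor A (rcons (enum (stars x)) t) (rcons (enum (tight x)) ord_max) =
  coord x t * wall_sign x t * minor A (enum (stars x)) (enum (tight x)).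
Proof.
move=> vx tS; apply: (minor_border (nu := @nu x)); rewrite -?cardE//.
- exact: (vertex_minor vx).1.
- by move=> j; rewrite mem_enum; exact: coord_star.
- exact: coord_bullet.
Qed.

Lemma bulletsE (x : n.-tuple R) : bullets x = (~: stars x)%SET.
Proof. by apply/setP => k; rewrite !inE negb_and !negbK. Qed.

Lemma vertex_clip x : vertex x -> (cube_face #|tight x|%:Z `&` clip A r (tight x)) x.
Proof.
move=> vx; have [Px fx _] := vx; have [cx _] := (feasibleP x).1 Px.
split; last exact: tight_clip.
by split => //=; rewrite (vertex_minor vx).1.
Qed.

Hypothesis clipB : forall I : {set 'I_m.+1}, ord_max \notin I ->
  forall v, (cube_face #|I|%:Z `&` clip A r I) v ->
  (\prod_(t in I) minor A (enum (stars v)) (enum (ord_max |: (I :\ t))%SET)) *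
  (\prod_(t in bullets v) minor A (enum (t |: stars v)%SET) (enum (ord_max |: I)%SET)) != 0.

(** The two families of factors in the second clipping condition are, up to
    sign and the nonzero minor of the vertex, the coefficients of the tight
    g_i and of the walls. *)
Lemma coord_neq0 x k : vertex x -> coord x k != 0.
Proof.
move=> vx; have [_ fx _] := vx; have maxI := max_tight fx.
have := clipB maxI (vertex_clip vx); rewrite mulf_eq0 negb_or => /andP[hI hb].
have [kS|kS] := boolP (k \in stars x).
  have kS' : (index k (enum (stars x)) < #|stars x|)%N by rewrite cardE index_mem mem_enum.
  set t := nth ord_max (enum (tight x)) (Ordinal kS').
  have tI : t \in tight x by rewrite -mem_enum mem_nth// -cardE (vertex_minor vx).1.
  move/prodf_neq0: hI => /(_ t tI).
  have tE := minor_tight (Ordinal kS') vx; rewrite -/t in tE.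
  rewrite enum_setU1_max; last by rewrite finset.in_setD1 (negbTE maxI) andbF.
  rewrite tE !mulf_eq0 !negb_or /nu /= nth_index ?mem_enum//.
  by move=> /and3P[].
move/prodf_neq0: hb => /(_ k); rewrite bulletsE inE => /(_ kS).
rewrite enum_setU1_max// -normr_eq0.
have -> : `|minor A (enum (k |: stars x)%SET) (rcons (enum (tight x)) ord_max)| =
    `|minor A (rcons (enum (stars x)) k) (rcons (enum (tight x)) ord_max)|.
  apply: norm_minor_perm; apply: uniq_perm; rewrite ?enum_uniq ?rcons_uniq ?mem_enum ?kS ?enum_uniq//.
  by move=> j; rewrite mem_rcons inE !mem_enum !inE.
by rewrite normr_eq0 minor_bullet// !mulf_eq0 !negb_or => /andP[/andP[]].
Qed.

(** Let there be K free coordinates and Z zeros, and put T = K (K + 1) / 2.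
    The product of the minors over the tight g_i carries the sign (-1)^(K + T)
    from the reordering of columns.  The factors - coord k contribute (-1)^K
    from the tight g_i.  For the walls, the bordered minors contain coord k at
    a zero but - coord k at a one, because the inner normal of the wall
    x_k = 1 is - e_k; this leaves (-1)^Z. *)
Lemma vertex_weight x : vertex x ->
  affine A r ord_max x ^+ n /
    (n`!%:R * `|\det (basis_mx x)| * \prod_k - coord x k) =
  clip_term A r (tight x) x.
Proof.
move=> vx; rewrite norm_det_basis /clip_term (vertex_minor vx).1.
have d0 := (vertex_minor vx).2.
set d := minor A _ _ in d0 *; set K := #|stars x|.
set T := ((K * K.+1) %/ 2)%N; set Z := #|zeros x|.
pose pS := \prod_(p < K) @nu x p.
pose pB := \prod_(k in ~: stars x) (coord x k * wall_sign x k).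
have sgn2 e : (-1) ^+ e * (-1) ^+ e = 1 :> R by rewrite -exprD addnn -signr_odd odd_double.
have -> : \prod_(t in tight x) minor A (enum (stars x))
    (rcons (enum (tight x :\ t)%SET) ord_max) = (-1) ^+ (K + T) * (pS * d ^+ K).
  rewrite (big_enum_nth _ ord_max _ (vertex_minor vx).1).
  under eq_bigr => q _ do rewrite minor_tight//.
  by rewrite big_split sign_replace_col big_split /= prodr_const card_ord.
have -> : \prod_(t in bullets x) minor A (rcons (enum (stars x)) t)
    (rcons (enum (tight x)) ord_max) = pB * d ^+ (n - K).
  have <- : #|~: stars x| = (n - K)%N by rewrite cardsCs finset.setCK card_ord.
  rewrite bulletsE -prodr_const -big_split.
  apply: eq_bigr => t; rewrite finset.in_setC => tS; exact: minor_bullet.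
have -> : \prod_k - coord x k = (-1) ^+ K * pS * ((-1) ^+ Z * pB).
  rewrite (bigID (mem (stars x))) /=; congr (_ * _).
    rewrite (big_enum_nth _ j0 _ erefl) -/K.
    under eq_bigr => p _ do rewrite -mulN1r.
    by rewrite big_split /= prodr_const card_ord.
  have -> : (-1) ^+ Z = \prod_(k in ~: stars x) - wall_sign x k.
    rewrite (bigID (mem (zeros x))) /= [X in _ * X]big1 ?mulr1 => [|k /andP[_]].
      rewrite (eq_bigl (mem (zeros x))) => [|k].
        rewrite -prodr_const; apply: eq_bigr => k; rewrite inE /wall_sign => ->.
        by [].
      by rewrite !inE; case: (tnth x k == 0); rewrite ?andbF.
    by rewrite inE /wall_sign => /negbTE ->; rewrite opprK.
  rewrite -big_split; apply: eq_big => [k|k kS]; first by rewrite finset.in_setC.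
  by rewrite /= /wall_sign; case: ifP => _; rewrite ?opprK; ring.
have nf : n`!%:R != 0 :> R by rewrite pnatr_eq0 -lt0n fact_gt0.
have sgn0 e : (-1) ^+ e != 0 :> R by rewrite signr_eq0.
have pS0 : pS != 0 by apply/prodf_neq0 => p _; exact: coord_neq0.
have pB0 : pB != 0.
  apply/prodf_neq0 => k _; rewrite mulf_neq0 ?coord_neq0//.
  by rewrite -normr_eq0 norm_wall_sign oner_eq0.
have dn : d ^+ n = d ^+ K * d ^+ (n - K).
  by rewrite -exprD subnKC// -[X in (_ <= X)%N](card_ord n) max_card.
have dK e : d ^+ e != 0 by rewrite expf_neq0.
rewrite !exprD exprMn dn -[LHS]mul1r -[X in X * _ = _](sgn2 Z).
move: ((-1) ^+ Z) ((-1) ^+ T) ((-1) ^+ K) (sgn0 Z) (sgn0 T) (sgn0 K) => z t k z0 t0 k0.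
field.
by rewrite nf pB0 pS0 !dK z0 t0 k0 normr_eq0 d0.
Qed.

End ClippedCube.

(** * The volume formula *)

Unset Implicit Arguments.

Theorem theorem4p6 (R : realType) (n m : nat) (hn : (0 < n)%N)
    (A : 'M[R]_(n, m.+1)) (r : 'I_m.+1 -> R)
    (hg : forall i : 'I_m.+1, exists x y : n.-tuple R,
        affine A r i x <> affine A r i y)
    (hclip : good_clipping A r) :
  lebesgueN R n (cube `&` halfspaces A r) =
  (\sum_(I : {set 'I_m.+1} | ord_max \notin I)
     \sum_(v \in cube_face #|I|%:Z `&` clip A r I) clip_term A r I v)%:E.
Proof.
case: hclip => clipA clipB.
have [vs vs_uniq vsP] := @vertices_enum R n m A r.
pose e u := basis A r (tuple_of_row u).
pose lam u (i : facet n m) : R := if [pick k | e u k == i] is Some k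
  then coord A r (tuple_of_row u) k else 0.
have lamE x k : vertex A r x -> lam (row_of_tuple x) (e (row_of_tuple x) k) = coord A r x k.
  move=> vx; rewrite /lam /e row_of_tupleK; case: pickP => [l /eqP/(basis_inj hn clipA vx) ->//|].
  by move=> /(_ k); rewrite eqxx.
have rowP u : u \in map (@row_of_tuple R n) vs ->
    exists2 x, vertex A r x & u = row_of_tuple x.
  by move=> /mapP[x /vsP vx ->]; exists x.
have volE := @lawrence_formula R n (facet n m) (@facet_normal R n m A)
  (@facet_offset R n m r) (fun j => A j ord_max) (r ord_max)
  (map (@row_of_tuple R n) vs) e lam.
rewrite [X in lebesgueN R n X](_ : _ = [set x | feasible (facet_form A r) (row_of_tuple x)]); last first.
  by apply/seteqP; split => x /feasibleP.
rewrite volE; clear volE.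
- rewrite big_map; congr (_%:E).
  transitivity (\sum_(x <- vs) clip_term A r (tight A r x) x).
    rewrite big_seq [RHS]big_seq; apply: eq_bigr => x /vsP vx.
    rewrite -(vertex_weight hn clipA clipB vx); congr (_ / (_ * _ * _)).
    - by congr (_ ^+ n); exact: facet_form_inl.
    - by congr `|\det _|; apply/matrixP => k j; rewrite !mxE /e row_of_tupleK.
    - by apply: eq_bigr => k _; rewrite lamE.
  (* each vertex x contributes exactly once, for I = tight x *)
  rewrite (eq_bigr (fun I : {set 'I_m.+1} =>
      \sum_(x <- vs | tight A r x == I) clip_term A r I x)); last first.
    move=> I maxI; rewrite -[RHS]big_filter [RHS]fsbig_seq ?filter_uniq//.
    apply: eq_fsbigl; apply/seteqP; split => x /=; rewrite mem_filter.
      by move=> /(clip_vertex hn clipA maxI)[/vsP -> ->]; rewrite eqxx.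
    by move=> /andP[/eqP <- /vsP vx]; exact: (vertex_clip hn clipA vx).
  rewrite (exchange_big_dep xpredT)//= big_seq [RHS]big_seq.
  apply: eq_bigr => x /vsP[_ fx _].
  rewrite (big_pred1 (tight A r x)) // => I; rewrite /= [in RHS]eq_sym.
  by apply/andP/idP => [[]//|/eqP <-]; split => //; exact: max_tight.
- by rewrite map_inj_uniq//; exact: can_inj (@row_of_tupleK R n).
- by move=> u /rowP[x [Px fx _] ->]; rewrite Px -(facet_form_inl A r) in fx *.
- by move=> u /rowP[x vx ->] k l; rewrite /e row_of_tupleK => /(basis_inj hn clipA vx).
- by move=> u /rowP[x vx ->]; rewrite /e row_of_tupleK; exact (active_basis hn clipA vx).
- move=> u /rowP[x vx ->]; rewrite /e row_of_tupleK.
  rewrite -normr_eq0 [X in `|\det X|](_ : _ = basis_mx A r x)//.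
  by rewrite norm_det_basis// normr_eq0 (vertex_minor hn clipA vx).2.
- move=> u j /rowP[x vx ->]; rewrite (coordE hn clipA j vx); apply: eq_bigr => k _.
  by rewrite lamE// mxE /e row_of_tupleK.
- by move=> u k /rowP[x vx ->]; rewrite lamE//; exact: (coord_neq0 hn clipA clipB).
- move=> u; rewrite -(tuple_of_rowK u) => Pu fu.
  have fu' : 0 < affine A r ord_max (tuple_of_row u).
    by rewrite -facet_form_inl.
  have [y vy [uy fuy]] := vertex_above Pu fu'.
  exists (row_of_tuple y); first by apply: map_f; apply/vsP.
  apply/andP; split; first exact: uy.
  by rewrite -!(facet_form_inl A r) in fuy.
- move=> [i|[k b]].
  + apply/existsP; apply: contraT => /existsPn h; have [x [y []]] := hg i.
    rewrite /affine !big1// => j _; have := h j; rewrite negbK => /eqP /= ->;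
      by rewrite mul0r.
  + by exists k => /=; rewrite eqxx mulr1n; case: b; rewrite ?oppr_eq0 oner_eq0.
- apply/existsP; apply: contraT => /existsPn h; have [x [y []]] := hg ord_max.
  by rewrite /affine !big1// => j _; have := h j; rewrite negbK => /eqP ->; rewrite mul0r.
- by move=> u /forallP/(_ (inl ord_max)).
Qed.
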